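(* Let $S$ be a unital semilattice. Then the $\ell^1$-convolution algebra $\mathcal{A}_S=\ell^1(S)$ is simplicially trivial, i.e. $\mathcal{H}^n(\mathcal{A}_S,\mathcal{A}_S')=0$ for all $n\geq 1$.
   Context: A semilattice is a commutative semigroup in which every element is idempotent ($s^2=s$); it is unital if it has an identity element. For a semigroup $S$, $\mathcal{A}_S=\ell^1(S)$ is the Banach algebra with convolution product, determined by $e_s e_t=e_{st}$, where $e_s$ is the basis vector that is $1$ at $s$ and $0$ elsewhere. For a Banach algebra $A$ and Banach $A$-bimodule $M$, let $\mathcal{C}^n(A,M)$ be the Banach space of bounded $n$-linear maps $A^n\to M$ ($n\ge 0$, with $\mathcal{C}^0(A,M)=M$), and define $\delta_n:\mathcal{C}^n(A,M)\to\mathcal{C}^{n+1}(A,M)$ by $$(\delta_nF)(a_1,\dots,a_{n+1})=a_1\cdot F(a_2,\dots,a_{n+1})+\sum_{j=1}^n(-1)^jF(a_1,\dots,a_ja_{j+1},\dots,a_{n+1})+(-1)^{n+1}F(a_1,\dots,a_n)\cdot a_{n+1}.$$ The Hochschild cohomology groups are $\mathcal{H}^n(A,M)=\ker\delta_n/\operatorname{Im}\delta_{n-1}$ (algebraic quotient of vector spaces; $\delta_{-1}=0$). $A'$ denotes the Banach space dual of $A$ with the canonically induced dual bimodule action. A Banach algebra $A$ is called simplicially trivial if $\mathcal{H}^n(A,A')=0$ for all $n\ge 1$. *)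

(* Defs.v *)
From HB Require Import structures.
From mathcomp Require Import all_boot all_order all_algebra.
From mathcomp Require Import finmap generic_quotient complex.
From mathcomp Require Import all_classical all_reals all_analysis.
From mathcomp Require Import ring lra.

Set Implicit Arguments.
Unset Strict Implicit.
Unset Printing Implicit Defensive.

Import Order.TTheory GRing.Theory Num.Theory.
Import numFieldNormedType.Exports.
Import ComplexField.Normc.

Local Open Scope classical_set_scope.
Local Open Scope ring_scope.
Local Open Scope complex_scope.

Section ComplexNorm.
Variable R : realType.
Implicit Types z : R[i].

Lemma normcEC z : `|z| = (normc z)%:C.
Proof. by []. Qed.

Lemma normc_ge0 z : 0 <= normc z.
Proof. by rewrite -ler0c -normcEC. Qed.

Lemma ler_normcD (x y : R[i]) : normc (x + y) <= normc x + normc y.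
Proof. exact: le_normcD. Qed.

Lemma normc_Re z : `|complex.Re z| <= normc z.
Proof. by rewrite -lecR -normcEC normc_ge_Re. Qed.

Lemma normc_Im z : `|complex.Im z| <= normc z.
Proof.
case: z => a b /=.
by rewrite -sqrtr_sqr ler_sqrt ?addr_ge0 ?sqr_ge0// lerDr sqr_ge0.
Qed.

Lemma normc_real (a : R) : 0 <= a -> normc a%:C = a.
Proof. by move=> a0; rewrite /= expr0n addr0 sqrtr_sqr ger0_norm. Qed.

Lemma normc_le_ReIm z : normc z <= `|complex.Re z| + `|complex.Im z|.
Proof.
rewrite -lecR -normcEC {1}[z]complexE (le_trans (ler_normD _ _))//.
rewrite rmorphD/= lerD//.
  by rewrite normcEC /= expr0n addr0 sqrtr_sqr.
by rewrite normrM !normcEC /= !expr0n add0r !addr0 expr1n sqrtr1 mul1r sqrtr_sqr.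
Qed.

Lemma pos_complexP (e : R[i]) : 0 < e -> exists2 r : R, 0 < r & e = r%:C.
Proof.
move=> e0; exists (complex.Re e); last first.
  by rewrite RRe_real// ger0_real// ltW.
by rewrite -ltcR RRe_real// ger0_real// ltW.
Qed.

Lemma nneg_complexP (e : R[i]) : 0 <= e -> exists2 r : R, 0 <= r & e = r%:C.
Proof.
move=> e0; exists (complex.Re e); last by rewrite RRe_real// ger0_real.
by rewrite -lecR RRe_real// ger0_real.
Qed.

End ComplexNorm.

(* The norm of a normed module over R[i] takes its values in R[i] (in its
   nonnegative reals); rnorm is the same norm as an element of R. *)
Definition rnorm (R : realType) (V : normedModType R[i]) (x : V) : R :=
  complex.Re `|x|.

Section RealNorm.
Variables (R : realType) (V : normedModType R[i]).
Implicit Types x : V.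

Lemma rnormE x : (rnorm x)%:C = `|x|.
Proof. by rewrite /rnorm RRe_real// ger0_real. Qed.

Lemma rnorm_ge0 x : 0 <= rnorm x.
Proof. by rewrite -ler0c rnormE. Qed.

Lemma le_rnorm x (r : R) : (`|x| <= r%:C) = (rnorm x <= r).
Proof. by rewrite -rnormE lecR. Qed.

End RealNorm.

Section Completeness.
Variables (R : realType) (V : normedModType R[i]) (X : Type).
Variables (ev : V -> X -> R[i]) (c : X -> R).
Hypothesis evB : forall f g x, ev (f - g) x = ev f x - ev g x.
Hypothesis ev_inj : forall f g, ev f = ev g -> f = g.
Hypothesis ev_bound : forall f x, normc (ev f x) <= c x * rnorm f.
Hypothesis ev_closed : forall (F : set_system V) (g : X -> R[i]) f (r : R),
  ProperFilter F ->
  (forall x (e : R), 0 < e -> \forall h \near F, normc (ev h x - g x) <= e) ->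
  (\forall h \near F, rnorm (h - f) <= r) ->
  exists2 h, ev h = g & rnorm (h - f) <= r.

Lemma complete_of_evaluations (F : set_system V) :
  ProperFilter F -> cauchy F -> cvg F.
Proof.
move=> PF /cauchy_ballP Fc.
have Fc' (e : R) : 0 < e -> \forall f & g \near F, rnorm (f - g) <= e.
  move=> e0; have e0' : (0 : R[i]) < e%:C by rewrite ltcR.
  apply: filterS (Fc _ e0') => -[f g] /=.
  by rewrite -ball_normE /= -le_rnorm => /ltW.
have c_ge0 (x : X) : 0 <= `|c x| + 1 by rewrite addr_ge0.
have c_gt0 (x : X) : 0 < `|c x| + 1 by rewrite ltr_pwDr.
have evc f x : normc (ev f x) <= (`|c x| + 1) * rnorm f.
  rewrite (le_trans (ev_bound _ _))// ler_wpM2r ?rnorm_ge0//.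
  by rewrite (le_trans (ler_norm _))// lerDl.
have real_lim (p : R[i] -> R) (x : X) :
    (forall y z, p (y - z) = p y - p z) -> (forall z, `|p z| <= normc z) ->
    cvg ((fun f => p (ev f x)) @ F).
  move=> pB ple; apply: R_complete; apply/cauchy_ballP => e e0.
  rewrite near_map2.
  have e0' : 0 < e / 2 / (`|c x| + 1) by rewrite !divr_gt0.
  apply: filterS (Fc' _ e0') => -[f g] /= H.
  rewrite -ball_normE /= -pB -evB (le_lt_trans (ple _))//.
  rewrite (le_lt_trans (evc _ _))// mulrC.
  rewrite (@le_lt_trans _ _ (e / 2))//; first by rewrite -ler_pdivlMr.
  by rewrite ltr_pdivrMr// ltr_pMr// ltr1n.
have ReB (y z : R[i]) : complex.Re (y - z) = complex.Re y - complex.Re z.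
  by case: y z => [? ?] [? ?].
have ImB (y z : R[i]) : complex.Im (y - z) = complex.Im y - complex.Im z.
  by case: y z => [? ?] [? ?].
pose g x : R[i] := lim ((fun f => complex.Re (ev f x)) @ F) +i*
                   lim ((fun f => complex.Im (ev f x)) @ F).
have gP x (e : R) : 0 < e -> \forall h \near F, normc (ev h x - g x) <= e.
  move=> e0; have e20 : 0 < e / 2 by rewrite divr_gt0.
  have /cvgrPdist_le/(_ _ e20) HRe := real_lim _ x ReB (@normc_Re R).
  have /cvgrPdist_le/(_ _ e20) HIm := real_lim _ x ImB (@normc_Im R).
  near=> h.
  rewrite (le_trans (normc_le_ReIm _))// ReB ImB [leRHS]splitr lerD//.
    by rewrite distrC /g /=; near: h.
  by rewrite distrC /g /=; near: h.
have [h0 evh0 _] : exists2 h, ev h = g & rnorm (h - 0) <= rnorm (h - 0).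
  have [f0 Hf0] : exists f0, \forall h \near F, rnorm (h - f0) <= 1.
    have [f0 Hf0] := filter_ex (nearP_dep (Fc' _ ltr01)).
    exists f0; apply: filterS Hf0 => f /=.
    by rewrite /rnorm distrC.
  by have [h hg _] := ev_closed PF gP Hf0; exists h.
apply/cvg_ex; exists h0; apply/fcvgrPdist_lt => e /pos_complexP[r r0 ->].
have r20 : 0 < r / 2 by rewrite divr_gt0.
apply: filterS (nearP_dep (Fc' _ r20)) => f Hf.
have [|h hg] := ev_closed PF gP (f := f) (r := r / 2).
  by apply: filterS Hf => f' /=; rewrite /rnorm distrC.
have -> : h = h0 by apply: ev_inj; rewrite hg evh0.
rewrite -rnormE ltcR => /le_lt_trans; apply.
by rewrite ltr_pdivrMr// ltr_pMr// ltr1n.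
Unshelve. all: by end_near. Qed.

End Completeness.

(* Banach algebras are not assumed to have a unit. *)
HB.mixin Record isBanachAlgebra (K : numFieldType) A
    & CompleteNormedModule K A := {
  bmul : A -> A -> A;
  bmulA : associative bmul;
  bmulDl : left_distributive bmul +%R;
  bmulDr : right_distributive bmul +%R;
  bmulZl : forall (k : K) (a b : A), bmul (k *: a) b = k *: bmul a b;
  bmulZr : forall (k : K) (a b : A), bmul a (k *: b) = k *: bmul a b;
  ler_norm_bmul : forall a b : A, `|bmul a b| <= `|a| * `|b|
}.

#[short(type="banachAlgType")]
HB.structure Definition BanachAlgebra (K : numFieldType) :=
  {A of CompleteNormedModule K A & isBanachAlgebra K A}.

Declare Scope banach_scope.
Delimit Scope banach_scope with banach.
Local Open Scope banach_scope.

Notation "a ** b" := (bmul a b) (at level 40, left associativity) : banach_scope.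

HB.mixin Record isBanachBimodule (K : numFieldType) (A : banachAlgType K) M
    & CompleteNormedModule K M := {
  lact : A -> M -> M;
  ract : M -> A -> M;
  lactA : forall (a b : A) (m : M), lact (a ** b) m = lact a (lact b m);
  ractA : forall (m : M) (a b : A), ract m (a ** b) = ract (ract m a) b;
  lractA : forall (a : A) (m : M) (b : A),
    ract (lact a m) b = lact a (ract m b);
  lactDl : forall (a b : A) (m : M), lact (a + b) m = lact a m + lact b m;
  lactDr : forall (a : A) (m n : M), lact a (m + n) = lact a m + lact a n;
  lactZl : forall (k : K) (a : A) (m : M), lact (k *: a) m = k *: lact a m;
  lactZr : forall (k : K) (a : A) (m : M), lact a (k *: m) = k *: lact a m;
  ractDl : forall (m n : M) (a : A), ract (m + n) a = ract m a + ract n a;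
  ractDr : forall (m : M) (a b : A), ract m (a + b) = ract m a + ract m b;
  ractZl : forall (k : K) (m : M) (a : A), ract (k *: m) a = k *: ract m a;
  ractZr : forall (k : K) (m : M) (a : A), ract m (k *: a) = k *: ract m a;
  bounded_lact : exists c : K, forall (a : A) (m : M),
    `|lact a m| <= c * `|a| * `|m|;
  bounded_ract : exists c : K, forall (m : M) (a : A),
    `|ract m a| <= c * `|m| * `|a|
}.

#[short(type="banachBimodType")]
HB.structure Definition BanachBimodule (K : numFieldType) (A : banachAlgType K)
  := {M of CompleteNormedModule K M & isBanachBimodule K A M}.

Notation "a *> m" := (lact a m) (at level 40) : banach_scope.
Notation "m <* a" := (ract m a) (at level 40) : banach_scope.


Section Cochains.
Context {K : numFieldType} (A M : completeNormedModType K).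

(* A^n is the type of functions 'I_n -> A. Since 'I_0 -> A has exactly one
   element, cochain 0 is M. *)
Definition set_arg n (v : 'I_n -> A) (i : 'I_n) (a : A) : 'I_n -> A :=
  fun j => if j == i then a else v j.

Definition multilinear n (F : ('I_n -> A) -> M) : Prop :=
  forall (v : 'I_n -> A) (i : 'I_n), linear (fun a : A => F (set_arg v i a)).

Definition multibounded n (F : ('I_n -> A) -> M) : Prop :=
  exists c : K, forall v : 'I_n -> A, `|F v| <= c * \prod_(i < n) `|v i|.

Definition cochain_pred n : {pred ('I_n -> A) -> M} :=
  [pred F | `[< multilinear F /\ multibounded F >]].

Record cochain n := Cochain {
  cochain_fun :> ('I_n -> A) -> M ;
  _ : cochain_fun \in @cochain_pred n }.

Lemma normr_leM (V : normedModType K) (y : V) (c x : K) :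
  0 <= x -> `|y| <= c * x -> `|y| <= `|c| * x.
Proof.
move=> x0 yc; have cx0 : 0 <= c * x by exact: le_trans yc.
by rewrite -[X in _ * X](ger0_norm x0) -normrM (ger0_norm cx0).
Qed.

Lemma multibounded_ge0 n (F : ('I_n -> A) -> M) : multibounded F ->
  exists2 c : K, 0 <= c & forall v, `|F v| <= c * \prod_(i < n) `|v i|.
Proof.
move=> [c Fc]; exists `|c|; first exact: normr_ge0.
by move=> v; apply: normr_leM; rewrite ?prodr_ge0.
Qed.

Lemma multilinearD n (F G : ('I_n -> A) -> M) (k : K) :
  multilinear F -> multilinear G -> multilinear (k *: F + G).
Proof.
move=> lF lG v i l a b.
rewrite (_ : (k *: F + G) _ =
   k *: F (set_arg v i (l *: a + b)) + G (set_arg v i (l *: a + b)))//.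
by rewrite lF lG !scalerDr !scalerA [k * l]mulrC addrACA.
Qed.

Lemma multiboundedD n (F G : ('I_n -> A) -> M) (k : K) :
  multibounded F -> multibounded G -> multibounded (k *: F + G).
Proof.
move=> [c Fc] [d Gd]; exists (`|k| * c + d) => v.
rewrite (le_trans (ler_normD _ _))// mulrDl lerD//.
by rewrite normrZ -mulrA ler_wpM2l.
Qed.

Fact cochain_submod n : submod_closed (@cochain_pred n).
Proof.
split=> [|k F G /asboolP[lF bF] /asboolP[lG bG]]; apply/asboolP; split.
- by move=> v i k a b; rewrite /= scaler0 addr0.
- by exists 0 => v; rewrite normr0 mul0r.
- exact: multilinearD.
- exact: multiboundedD.
Qed.

HB.instance Definition _ n := GRing.isSubmodClosed.Build K
  (('I_n -> A) -> M) (@cochain_pred n) (cochain_submod n).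
HB.instance Definition _ n := [isSub for @cochain_fun n].
HB.instance Definition _ n := [Choice of cochain n by <:].
HB.instance Definition _ n := [SubChoice_isSubLmodule of cochain n by <:].

Lemma cochainP n (F : cochain n) : multilinear F /\ multibounded F.
Proof. by case: F => F /= /asboolP. Qed.

End Cochains.

Section Coboundary.
Context {K : numFieldType} (A : banachAlgType K) (M : banachBimodType A).

(* The tuple with two adjacent entries multiplied. Indices start at 0, so that
   merge_args j v contains v_j v_(j+1) and its sign in coboundary_fun is
   (-1)^(j+1). *)
Definition merge_args n (j : 'I_n) (v : 'I_n.+1 -> A) : 'I_n -> A := fun i =>
  if (i < j)%N then v (widen_ord (leqnSn n) i)
  else if i == j then v (widen_ord (leqnSn n) i) ** v (lift ord0 i)
  else v (lift ord0 i).

Definition coboundary_fun n (F : ('I_n -> A) -> M) (v : 'I_n.+1 -> A) : M :=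
  v ord0 *> F (fun i => v (lift ord0 i))
  + \sum_(j < n) (-1) ^+ j.+1 *: F (merge_args j v)
  + (-1) ^+ n.+1 *: (F (fun i => v (widen_ord (leqnSn n) i)) <* v ord_max).

Lemma upd_lift0 n (v : 'I_n.+1 -> A) a :
  (fun i : 'I_n => set_arg v ord0 a (lift ord0 i)) = fun i => v (lift ord0 i).
Proof. by apply/funext => i; rewrite /set_arg. Qed.

Lemma upd_lift n (v : 'I_n.+1 -> A) k a :
  (fun i : 'I_n => set_arg v (lift ord0 k) a (lift ord0 i)) =
  set_arg (fun i => v (lift ord0 i)) k a.
Proof. by apply/funext => i; rewrite /set_arg (inj_eq lift_inj). Qed.

Lemma upd_widen_max n (v : 'I_n.+1 -> A) a :
  (fun i : 'I_n => set_arg v ord_max a (widen_ord (leqnSn n) i)) =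
  fun i => v (widen_ord (leqnSn n) i).
Proof. by apply/funext => i; rewrite /set_arg -val_eqE/= ltn_eqF. Qed.

Lemma upd_widen n (v : 'I_n.+1 -> A) (k : 'I_n) a :
  (fun i : 'I_n => set_arg v (widen_ord (leqnSn n) k) a (widen_ord (leqnSn n) i)) =
  set_arg (fun i => v (widen_ord (leqnSn n) i)) k a.
Proof. by apply/funext => i; rewrite /set_arg -!val_eqE. Qed.

Lemma upd_same n (v : 'I_n.+1 -> A) i a : set_arg v i a i = a.
Proof. by rewrite /set_arg eqxx. Qed.

Lemma ord_last n (i : 'I_n.+1) :
  i = ord_max \/ exists k : 'I_n, i = widen_ord (leqnSn n) k.
Proof.
have := ltn_ord i; rewrite ltnS leq_eqVlt => /predU1P[e|lt].
  by left; apply: val_inj.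
by right; exists (Ordinal lt); apply: val_inj.
Qed.

Lemma merge_upd n (j : 'I_n) (v : 'I_n.+1 -> A) (i : 'I_n.+1) :
  exists (k : 'I_n) (f : A -> A), linear f /\
    forall a, merge_args j (set_arg v i a) = set_arg (merge_args j v) k (f a).
Proof.
have [ltij|leji] := ltnP i j.
  exists (Ordinal (ltn_trans ltij (ltn_ord j))), id; split=> // a.
  apply/funext => l; rewrite /merge_args /set_arg -!val_eqE /= /bump leq0n add1n.
  case: (ltnP l j) => [|jl]; first by [].
  have li : (l == i :> nat) = false by rewrite gtn_eqF// (leq_trans ltij).
  have l1i : (l.+1 == i) = false.
    by rewrite gtn_eqF// (leq_trans ltij)// (leq_trans jl).
  by rewrite li l1i.
have [/eqP eij|neij] := boolP (i == j :> nat).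
  exists j, (fun a => a ** v (lift ord0 j)); split=> [k a b|a].
    by rewrite bmulDl bmulZl.
  apply/funext => l; rewrite /merge_args /set_arg -!val_eqE /= /bump leq0n add1n eij.
  have [ltlj|ltjl|/val_inj->] := ltngtP (l : nat) j.
  - by [].
  - by rewrite gtn_eqF// ltnW.
  - by rewrite gtn_eqF.
have ltji : (j < i)%N by rewrite ltn_neqAle eq_sym neij.
have [/eqP eij|neij1] := boolP (i == j.+1 :> nat).
  exists j, (fun a => v (widen_ord (leqnSn n) j) ** a); split=> [k a b|a].
    by rewrite bmulDr bmulZr.
  apply/funext => l; rewrite /merge_args /set_arg -!val_eqE /= /bump leq0n add1n eij.
  have [ltlj|ltjl|/val_inj->] := ltngtP (l : nat) j.
  - by rewrite ltn_eqF// (ltn_trans ltlj).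
  - by rewrite eqSS gtn_eqF.
  - by rewrite eqxx ltn_eqF.
have ltj1i : (j.+1 < i)%N by rewrite ltn_neqAle eq_sym neij1.
have i0 : (0 < i)%N by rewrite (leq_trans _ ltj1i).
have lti : (i.-1 < n)%N by rewrite -ltnS prednK.
exists (Ordinal lti), id; split=> // a.
apply/funext => l; rewrite /merge_args /set_arg -!val_eqE /= /bump leq0n add1n.
have [ltlj|ltjl|/val_inj->] := ltngtP (l : nat) j.
- rewrite !ltn_eqF//; first by rewrite -ltnS prednK// (leq_trans _ ltj1i)// ltnW.
  by rewrite (ltn_trans ltlj).
- by rewrite -(prednK i0) eqSS.
- rewrite !ltn_eqF//; first by rewrite -ltnS prednK.
Qed.

Lemma coboundary_multilinear n (F : ('I_n -> A) -> M) :
  multilinear F -> multilinear (coboundary_fun F).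
Proof.
move=> lF v i k a b; rewrite /coboundary_fun.
set c := k *: a + b.
have E1 : set_arg v i c ord0 *> F (fun l => set_arg v i c (lift ord0 l)) =
    k *: (set_arg v i a ord0 *> F (fun l => set_arg v i a (lift ord0 l))) +
    set_arg v i b ord0 *> F (fun l => set_arg v i b (lift ord0 l)).
  case: (unliftP ord0 i) => [l|] ->.
    by rewrite !upd_lift lF lactDr lactZr /set_arg.
  by rewrite !upd_lift0 !upd_same lactDl lactZl.
have E2 j : F (merge_args j (set_arg v i c)) =
    k *: F (merge_args j (set_arg v i a)) + F (merge_args j (set_arg v i b)).
  have [l [f [lf mf]]] := merge_upd j v i.
  by rewrite !mf lf lF.
have E3 : F (fun l => set_arg v i c (widen_ord (leqnSn n) l)) <* set_arg v i c ord_max =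
    k *: (F (fun l => set_arg v i a (widen_ord (leqnSn n) l)) <* set_arg v i a ord_max) +
    F (fun l => set_arg v i b (widen_ord (leqnSn n) l)) <* set_arg v i b ord_max.
  have [->|[l ->]] := ord_last i.
    by rewrite !upd_widen_max !upd_same ractDr ractZr.
  rewrite !upd_widen lF ractDl ractZl.
  by rewrite /set_arg -!val_eqE/= gtn_eqF.
rewrite E1 E3; under eq_bigr do rewrite E2 scalerDr scalerA mulrC -scalerA.
rewrite big_split/= -scaler_sumr !scalerDr [_ *: (k *: _)]scalerA.
rewrite [_ ^+ _ * k]mulrC -scalerA.
by rewrite [RHS]addrACA; congr (_ + _); exact: addrACA.
Qed.

Lemma prod_merge n (j : 'I_n) (v : 'I_n.+1 -> A) :
  \prod_(i < n) `|merge_args j v i| <= \prod_(i < n.+1) `|v i|.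
Proof.
rewrite (bigD1_ord (lift ord0 j))//= (bigD1 j)//= [X in _ <= _ * X](bigD1 j)//=.
rewrite mulrA; apply: ler_pM => //; first exact: prodr_ge0.
  rewrite /merge_args ltnn eqxx (le_trans (ler_norm_bmul _ _))// mulrC.
  rewrite (_ : lift (lift ord0 j) j = widen_ord (leqnSn n) j)//.
  by apply: val_inj; rewrite /= /bump leq0n add1n ltnn.
rewrite le_eqVlt; apply/orP; left; apply/eqP; apply: eq_bigr => i nij.
congr (`| _ |); rewrite /merge_args (negPf nij).
have [ij|ji] := ltnP i j; congr v; apply: val_inj; rewrite /= /bump leq0n !add1n.
  by rewrite ltnNge (ltnW ij).
by rewrite ltn_neqAle ji eq_sym val_eqE nij.
Qed.

Lemma coboundary_multibounded n (F : ('I_n -> A) -> M) :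
  multibounded F -> multibounded (coboundary_fun F).
Proof.
move=> /multibounded_ge0[c c0 Fc].
have [d Ad] := @bounded_lact K A M; have [e Ae] := @bounded_ract K A M.
exists (`|d| * c + \sum_(j < n) c + `|e| * c) => v.
rewrite (le_trans (ler_normD _ _))// mulrDl lerD//.
  rewrite (le_trans (ler_normD _ _))// mulrDl lerD//.
    have -> : `|d| * c * \prod_(i < n.+1) `|v i| =
        `|d| * (`|v ord0| * (c * \prod_(i < n) `|v (lift ord0 i)|)).
      by rewrite big_ord_recl -!mulrA; congr (_ * _); rewrite mulrCA.
    set m := F _; have := Ad (v ord0) m; rewrite -mulrA => H.
    rewrite (le_trans (normr_leM _ H)) ?mulr_ge0//.
    by rewrite !ler_wpM2l// Fc.
  rewrite mulr_suml (le_trans (ler_norm_sum _ _ _))// ler_sum// => j _.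
  rewrite normrZ normrX normrN1 expr1n mul1r (le_trans (Fc _))//.
  by rewrite ler_wpM2l// prod_merge.
rewrite normrZ normrX normrN1 expr1n mul1r.
have -> : `|e| * c * \prod_(i < n.+1) `|v i| =
    `|e| * (c * \prod_(i < n) `|v (widen_ord (leqnSn n) i)| * `|v ord_max|).
  by rewrite big_ord_recr -!mulrA.
set m := F _; have := Ae m (v ord_max); rewrite -mulrA => H.
rewrite (le_trans (normr_leM _ H)) ?mulr_ge0//.
by rewrite ler_wpM2l// ler_wpM2r// Fc.
Qed.

Fact coboundary_subproof n (F : cochain A M n) :
  coboundary_fun F \in @cochain_pred K A M n.+1.
Proof.
have [lF bF] := cochainP F.
by apply/asboolP; split;
  [exact: coboundary_multilinear|exact: coboundary_multibounded].
Qed.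

Definition coboundary n (F : cochain A M n) : cochain A M n.+1 :=
  Cochain (coboundary_subproof F).

Fact coboundary_is_linear n : linear (@coboundary n).
Proof.
move=> k F G; apply: val_inj; apply/funext => v.
rewrite [LHS](_ : _ = coboundary_fun (k *: F + G) v)//.
rewrite [RHS](_ : _ = k *: coboundary_fun F v + coboundary_fun G v)//.
rewrite /coboundary_fun.
have E (u : 'I_n -> A) : (k *: F + G) u = k *: F u + G u by [].
rewrite !E lactDr lactZr ractDl ractZl.
under eq_bigr do rewrite E scalerDr scalerA mulrC -scalerA.
rewrite big_split/= -scaler_sumr !scalerDr [_ *: (k *: _)]scalerA.
rewrite [_ ^+ _ * k]mulrC -scalerA.
by rewrite [RHS]addrACA; congr (_ + _); exact: addrACA.
Qed.

HB.instance Definition _ n := GRing.isLinear.Build K (cochain A M n)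
  (cochain A M n.+1) *:%R (@coboundary n) (@coboundary_is_linear n).

Definition cocycle_pred n : {pred cochain A M n} :=
  [pred F | coboundary F == 0].

Lemma cocycleP n (F : cochain A M n) :
  reflect (coboundary F = 0) (F \in @cocycle_pred n).
Proof. exact: eqP. Qed.

Fact cocycle_submod n : submod_closed (@cocycle_pred n).
Proof.
split=> [|k F G /cocycleP F0 /cocycleP G0]; apply/cocycleP.
  by rewrite linear0.
by rewrite linearP /= F0 G0 scaler0 addr0.
Qed.

HB.instance Definition _ n := GRing.isSubmodClosed.Build K
  (cochain A M n) (@cocycle_pred n) (@cocycle_submod n).

Record cocycle n := Cocycle {
  cocycle_val :> cochain A M n ;
  _ : cocycle_val \in @cocycle_pred n }.

HB.instance Definition _ n := [isSub for @cocycle_val n].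
HB.instance Definition _ n := [Choice of cocycle n by <:].
HB.instance Definition _ n := [SubChoice_isSubLmodule of cocycle n by <:].

Definition is_coboundary n : cochain A M n -> Prop :=
  match n with
  | 0 => fun F => F = 0
  | m.+1 => fun F => exists G : cochain A M m, coboundary G = F
  end.

(* This is the congruence on ker delta_n modulo Im delta_(n-1); the inclusion of
   the latter in the former is not needed to form the quotient. *)
Definition cohomologous n : rel (cocycle n) :=
  fun F G => `[< is_coboundary (val F - val G) >].

Fact cohomologous_equiv n : equiv_class_of (@cohomologous n).
Proof.
split.
- move=> F; apply/asboolP; rewrite subrr; case: n F => //= n F.
  by exists 0; rewrite linear0.
- move=> F G; apply/asbool_equiv_eq; rewrite -[val F - val G]opprB.
  case: n F G => [|n] F G /=.
    by split=> [/eqP|->]; rewrite ?oppr0// oppr_eq0 => /eqP.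
  split=> -[H HE]; exists (- H); rewrite linearN/= HE ?opprK//.
- move=> G F H /asboolP FG /asboolP GH; apply/asboolP.
  rewrite -(subrKA (val G)).
  case: n F G H FG GH => [|n] F G H /=.
    by move=> -> ->; rewrite addr0.
  by move=> [I <-] [J <-]; exists (I + J); rewrite linearD.
Qed.

Canonical cohomologous_equivRel n := EquivRelPack (@cohomologous_equiv n).

Definition Hochschild n := {eq_quot @cohomologous n}%qT.

Definition Hochschild_trivial n : Prop :=
  forall c : Hochschild n, c = (\pi_(Hochschild n) 0)%qT.

Lemma Hochschild_trivialP n : Hochschild_trivial n <->
  forall F : cochain A M n, coboundary F = 0 -> is_coboundary F.
Proof.
split=> [H F dF|H c].
  have Fc : F \in @cocycle_pred n by apply/cocycleP.
  have /eqP := H (\pi_(Hochschild n) (Cocycle Fc))%qT.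
  by rewrite piE /= => /asboolP; rewrite /= subr0.
elim/quotW: c => F; apply/eqP; rewrite piE; apply/asboolP.
by rewrite /= subr0; apply: H; case: F => F /= /cocycleP.
Qed.

End Coboundary.

Arguments Hochschild {K} A M n.
Arguments Hochschild_trivial {K} A M n.

Section Dual.
Context {R : realType} (V : normedModType R[i]).
Implicit Types (x : V) (k : R[i]).

Definition dual_pred : {pred V -> R[i]^o} := [pred phi : V -> R[i]^o |
  `[< linear phi /\ exists c : R, forall x, normc (phi x) <= c * rnorm x >]].

Record dual := Dual {
  dual_fun :> V -> R[i]^o ;
  _ : dual_fun \in dual_pred }.

Fact dual_submod : submod_closed dual_pred.
Proof.
split=> [|k f g /asboolP[lf [c fc]] /asboolP[lg [d gd]]]; apply/asboolP; split.
- by move=> k x y; rewrite /= scaler0 addr0.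
- by exists 0 => x; rewrite mul0r [_ x](_ : _ = 0)// normc0.
- move=> l x y.
  have E z : (k *: f + g) z = k *: f z + g z by [].
  by rewrite !E lf lg !scalerDr !scalerA [k * l]mulrC addrACA.
- exists (normc k * c + d) => x.
  rewrite [(k *: f + g) x](_ : _ = k * f x + g x)//.
  rewrite (le_trans (ler_normcD _ _))// mulrDl lerD//.
  by rewrite normcM -mulrA ler_wpM2l// normc_ge0.
Qed.

HB.instance Definition _ := GRing.isSubmodClosed.Build R[i]
  (V -> R[i]^o) dual_pred dual_submod.
HB.instance Definition _ := [isSub for dual_fun].
HB.instance Definition _ := [Choice of dual by <:].
HB.instance Definition _ := [SubChoice_isSubLmodule of dual by <:].

Implicit Types f g : dual.

Lemma dual_linear f : linear f.
Proof. by case: f => f /= /asboolP[]. Qed.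

Lemma dual_bounded f : exists c : R, forall x, normc (f x) <= c * rnorm x.
Proof. by case: f => f /= /asboolP[]. Qed.

HB.instance Definition _ f := GRing.isLinear.Build R[i] V R[i]^o *:%R f
  (dual_linear f).

Definition dual_norm f : R :=
  sup [set normc (f x) | x in [set x : V | rnorm x <= 1]].

Lemma rnorm0 : rnorm (0 : V) = 0.
Proof. by rewrite /rnorm normr0. Qed.

Lemma rnormZ k x : rnorm (k *: x) = normc k * rnorm x.
Proof. by apply: complexI; rewrite rmorphM/= !rnormE normrZ. Qed.

Lemma rnorm_eq0 x : (rnorm x == 0) = (x == 0).
Proof. by rewrite -[RHS]normr_eq0 -rnormE -(inj_eq (@complexI R)). Qed.

Lemma dual_norm_has_sup f :
  has_sup [set normc (f x) | x in [set x : V | rnorm x <= 1]].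
Proof.
split; first by exists (normc (f 0)), 0 => //=; rewrite rnorm0.
have [c fc] := dual_bounded f.
exists `|c| => _ [x /= x1 <-]; rewrite (le_trans (fc _))//.
rewrite (le_trans (ler_norm _))// normrM ler_piMr//.
by rewrite ger0_norm// rnorm_ge0.
Qed.

Lemma dual_norm_ge0 f : 0 <= dual_norm f.
Proof.
apply: le_trans (sup_upper_bound (dual_norm_has_sup f) _).
  exact: (normc_ge0 (f 0)).
by exists 0 => //=; rewrite rnorm0.
Qed.

Lemma dual_normP f x : normc (f x) <= dual_norm f * rnorm x.
Proof.
have [->|x0] := eqVneq x 0; first by rewrite linear0 normc0 rnorm0 mulr0.
have rx0 : 0 < rnorm x by rewrite lt_def rnorm_eq0 x0 rnorm_ge0.
rewrite -ler_pdivrMr//.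
apply: le_trans (sup_upper_bound (dual_norm_has_sup f) _); first exact: lexx.
exists ((rnorm x)^-1%:C *: x) => /=.
  by rewrite rnormZ normc_real ?invr_ge0 ?rnorm_ge0// mulVf ?gt_eqF.
by rewrite linearZ/= normcM normc_real ?invr_ge0 ?rnorm_ge0// mulrC.
Qed.

Lemma dual_norm_le f (c : R) : 0 <= c ->
  (forall x, normc (f x) <= c * rnorm x) -> dual_norm f <= c.
Proof.
move=> c0 fc; apply: ge_sup => [|_ [x /= x1 <-]].
  by have [] := dual_norm_has_sup f.
by rewrite (le_trans (fc _))// ler_piMr.
Qed.

Definition dual_normC f : R[i] := (dual_norm f)%:C.

Fact dual_normD f g : dual_normC (f + g) <= dual_normC f + dual_normC g.
Proof.
rewrite /dual_normC -rmorphD/= lecR.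
apply: dual_norm_le => [|x]; first by rewrite addr_ge0 ?dual_norm_ge0.
rewrite [(f + g) x](_ : _ = f x + g x)//.
by rewrite (le_trans (ler_normcD _ _))// mulrDl lerD// dual_normP.
Qed.

Lemma dual_normZ_le k f : dual_norm (k *: f) <= normc k * dual_norm f.
Proof.
apply: dual_norm_le => [|x]; first by rewrite mulr_ge0 ?dual_norm_ge0 ?normc_ge0.
rewrite [(k *: f) x](_ : _ = k * f x)// normcM -mulrA.
by rewrite ler_wpM2l ?normc_ge0 ?dual_normP.
Qed.

Fact dual_normZ k f : dual_normC (k *: f) = `|k| * dual_normC f.
Proof.
rewrite /dual_normC normcEC -rmorphM/=; congr (_%:C).
apply/le_anti; rewrite dual_normZ_le/=.
have [->|k0] := eqVneq k 0; first by rewrite normc0 mul0r dual_norm_ge0.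
have := dual_normZ_le k^-1 (k *: f).
rewrite scalerA mulVf// scale1r normcV mulrC ler_pdivlMr 1?mulrC//.
by rewrite lt_def normc_ge0 andbT; apply: contra k0 => /eqP/eq0_normc ->.
Qed.

Fact dual_normC_eq0 f : dual_normC f = 0 -> f = 0.
Proof.
move=> /complexI f0; apply: val_inj; apply/funext => x /=.
apply: eq0_normc; apply/le_anti; rewrite normc_ge0 andbT.
by rewrite (le_trans (dual_normP _ _))// f0 mul0r.
Qed.

HB.instance Definition _ := Lmodule_isNormed.Build R[i] dual
  dual_normD dual_normZ dual_normC_eq0.

Lemma rnorm_dual f : rnorm f = dual_norm f.
Proof. by []. Qed.

Fact dual_complete (F : set_system dual) :
  ProperFilter F -> cauchy F -> cvg F.
Proof.
apply: (@complete_of_evaluations R dual V (fun f x => f x) (@rnorm R V)).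
- by [].
- by move=> f g fg; apply: val_inj.
- by move=> f x; rewrite rnorm_dual mulrC dual_normP.
move=> {}F g f r PF Fg Fr.
have gN (e : R) x : 0 < e -> exists2 h : dual, normc (h x - g x) <= e &
    rnorm (h - f) <= r.
  by move=> e0; have [h []] := filter_ex (filterI (Fg x e e0) Fr); exists h.
have gE (e : R) (s : seq V) : 0 < e -> exists2 h : dual,
     {in s, forall x, normc (h x - g x) <= e} & rnorm (h - f) <= r.
  move=> e0.
  have [|h []] := @filter_ex _ F _
    (fun h => {in s, forall x, normc (h x - g x) <= e} /\ rnorm (h - f) <= r).
    apply: filterI => //; elim: s => [|x s IHs]; first exact: nearW.
    apply: filterS2 (Fg x e e0) IHs => h hx hs y.
    by rewrite in_cons => /predU1P[->//|]; exact: hs.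
  by exists h.
have lin_g : linear (g : V -> R[i]^o).
  move=> k x y; apply/subr0_eq/eq0_normc/le_anti; rewrite normc_ge0 andbT.
  apply/ler_addgt0Pr => e e0; rewrite add0r.
  have d0 : 0 < e / (2 + normc k).
    by rewrite divr_gt0// ltr_pwDl// normc_ge0.
  have [h hg _] := gE _ [:: k *: x + y; x; y] d0.
  have -> : g (k *: x + y) - (k *: (g x : R[i]^o) + g y) =
     - (h (k *: x + y) - g (k *: x + y)) + (k * (h x - g x) + (h y - g y)).
    have Z (a : R[i]^o) : k *: a = k * a by [].
    have E (a b c p q : R[i]) :
      c - (k * a + b) = - (k * p + q - c) + (k * (p - a) + (q - b)) by ring.
    by rewrite [h (k *: x + y)]dual_linear !Z; exact: E.
  rewrite (le_trans (ler_normcD _ _))// normcN.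
  have -> : e = e / (2 + normc k) + (normc k * (e / (2 + normc k)) + e / (2 + normc k)).
    by field; rewrite gt_eqF// ltr_pwDl// normc_ge0.
  rewrite lerD ?hg ?mem_head//.
  rewrite (le_trans (ler_normcD _ _))// normcM lerD//.
    by rewrite ler_wpM2l ?normc_ge0// hg// !inE eqxx orbT.
  by rewrite hg// !inE eqxx !orbT.
have bd_g x : normc (g x - f x) <= r * rnorm x.
  apply/ler_addgt0Pr => e e0.
  have [h hg hf] := gN e x e0.
  have -> : g x - f x = (h - f) x - (h x - g x).
    have E (a b c : R[i]) : a - b = (c - b) - (c - a) by ring.
    exact: E.
  rewrite (le_trans (ler_normcD _ _))// normcN lerD//.
  by rewrite (le_trans (dual_normP _ _))// ler_wpM2r ?rnorm_ge0// -rnorm_dual.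
have r0 : 0 <= r.
  have [h _ hf] := gN 1 0 ltr01; exact: le_trans (rnorm_ge0 _) hf.
have gP : (g : V -> R[i]^o) \in dual_pred.
  apply/asboolP; split=> //; exists (r + dual_norm f) => x.
  rewrite -[g x](subrK (f x)) (le_trans (ler_normcD _ _))// mulrDl lerD//.
  exact: dual_normP.
by exists (Dual gP) => //; rewrite rnorm_dual; exact: dual_norm_le.
Qed.

HB.instance Definition _ := Uniform_isComplete.Build dual dual_complete.

End Dual.

Section DualBimodule.
Context {R : realType} (A : banachAlgType R[i]).
Implicit Types (a b : A) (f g : dual A) (k : R[i]).

Lemma rnorm_bmul a b : rnorm (a ** b) <= rnorm a * rnorm b.
Proof. by rewrite -lecR rmorphM/= !rnormE ler_norm_bmul. Qed.

Fact dual_lact_subproof a f :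
  ((fun b => f (b ** a)) : A -> R[i]^o) \in @dual_pred R A.
Proof.
apply/asboolP; split=> [k b c|]; first by rewrite bmulDl bmulZl linearP.
exists (dual_norm f * rnorm a) => b.
rewrite (le_trans (dual_normP _ _))// -mulrA ler_wpM2l ?dual_norm_ge0//.
by rewrite mulrC rnorm_bmul.
Qed.

Fact dual_ract_subproof f a :
  ((fun b => f (a ** b)) : A -> R[i]^o) \in @dual_pred R A.
Proof.
apply/asboolP; split=> [k b c|]; first by rewrite bmulDr bmulZr linearP.
exists (dual_norm f * rnorm a) => b.
rewrite (le_trans (dual_normP _ _))// -mulrA ler_wpM2l ?dual_norm_ge0//.
exact: rnorm_bmul.
Qed.

(* The dual actions are (a . f)(b) = f(b a) and (f . a)(b) = f(a b). *)
Definition dual_lact a f : dual A := Dual (dual_lact_subproof a f).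
Definition dual_ract f a : dual A := Dual (dual_ract_subproof f a).

Fact dual_bounded_lact :
  exists c : R[i], forall a f, `|dual_lact a f| <= c * `|a| * `|f|.
Proof.
exists 1 => a f; rewrite mul1r -!rnormE -rmorphM/= lecR !rnorm_dual.
apply: dual_norm_le => [|b]; first by rewrite mulr_ge0 ?rnorm_ge0 ?dual_norm_ge0.
rewrite /= (le_trans (dual_normP _ _))// [rnorm a * _]mulrC -mulrA.
by rewrite ler_wpM2l ?dual_norm_ge0// mulrC rnorm_bmul.
Qed.

Fact dual_bounded_ract :
  exists c : R[i], forall f a, `|dual_ract f a| <= c * `|f| * `|a|.
Proof.
exists 1 => f a; rewrite mul1r -!rnormE -rmorphM/= lecR !rnorm_dual.
apply: dual_norm_le => [|b]; first by rewrite mulr_ge0 ?rnorm_ge0 ?dual_norm_ge0.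
rewrite /= (le_trans (dual_normP _ _))// -mulrA ler_wpM2l ?dual_norm_ge0//.
exact: rnorm_bmul.
Qed.

Let ext (f g : dual A) : (forall b, f b = g b) -> f = g.
Proof. by move=> fg; apply/val_inj/funext. Qed.

Fact dual_lactA a b f : dual_lact (a ** b) f = dual_lact a (dual_lact b f).
Proof. by apply: ext => c /=; rewrite bmulA. Qed.

Fact dual_ractA f a b : dual_ract f (a ** b) = dual_ract (dual_ract f a) b.
Proof. by apply: ext => c /=; rewrite bmulA. Qed.

Fact dual_lractA a f b :
  dual_ract (dual_lact a f) b = dual_lact a (dual_ract f b).
Proof. by apply: ext => c /=; rewrite bmulA. Qed.

Fact dual_lactDl a b f : dual_lact (a + b) f = dual_lact a f + dual_lact b f.
Proof. by apply: ext => c /=; rewrite bmulDr linearD. Qed.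

Fact dual_lactDr a f g : dual_lact a (f + g) = dual_lact a f + dual_lact a g.
Proof. exact: ext. Qed.

Fact dual_lactZl k a f : dual_lact (k *: a) f = k *: dual_lact a f.
Proof. by apply: ext => c /=; rewrite bmulZr linearZ. Qed.

Fact dual_lactZr k a f : dual_lact a (k *: f) = k *: dual_lact a f.
Proof. exact: ext. Qed.

Fact dual_ractDl f g a : dual_ract (f + g) a = dual_ract f a + dual_ract g a.
Proof. exact: ext. Qed.

Fact dual_ractDr f a b : dual_ract f (a + b) = dual_ract f a + dual_ract f b.
Proof. by apply: ext => c /=; rewrite bmulDl linearD. Qed.

Fact dual_ractZl k f a : dual_ract (k *: f) a = k *: dual_ract f a.
Proof. exact: ext. Qed.

Fact dual_ractZr k f a : dual_ract f (k *: a) = k *: dual_ract f a.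
Proof. by apply: ext => c /=; rewrite bmulZl linearZ. Qed.

HB.instance Definition _ := isBanachBimodule.Build R[i] A (dual A)
  dual_lactA dual_ractA dual_lractA dual_lactDl dual_lactDr dual_lactZl
  dual_lactZr dual_ractDl dual_ractDr dual_ractZl dual_ractZr
  dual_bounded_lact dual_bounded_ract.

End DualBimodule.

Definition simplicially_trivial (R : realType) (A : banachAlgType R[i]) : Prop :=
  forall n : nat, (1 <= n)%N -> Hochschild_trivial A (dual A) n.

Section AbsoluteSums.
Context {R : realType}.

Definition abs_esum (T : choiceType) (D : set T) (f : T -> R[i]) : \bar R :=
  \esum_(x in D) (normc (f x))%:E.

(* esum is meant for nonnegative families: absolutely summable real families
   are summed through their positive and negative parts, complex ones through
   their real and imaginary parts. *)
Definition rsum (T : choiceType) (D : set T) (f : T -> R) : R :=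
  fine (\esum_(x in D) (f^\+ x)%:E) - fine (\esum_(x in D) (f^\- x)%:E).

Definition csum (T : choiceType) (D : set T) (f : T -> R[i]) : R[i] :=
  rsum D (fun x => complex.Re (f x)) +i* rsum D (fun x => complex.Im (f x)).

Variable T : choiceType.
Implicit Types (D E : set T) (f g : T -> R[i]) (p q : T -> R).

Lemma rposneg p x : p^\+ x - p^\- x = p x.
Proof. by rewrite -[in RHS](funrposBneg p). Qed.

Lemma esumZ D (a : T -> \bar R) (c : R) : 0 <= c ->
  (forall x, (0 <= a x)%E) ->
  (\esum_(x in D) (c%:E * a x) = c%:E * \esum_(x in D) a x)%E.
Proof.
move=> c0 a0.
have le (d : R) (b : T -> \bar R) : 0 <= d -> (forall x, (0 <= b x)%E) ->
    (\esum_(x in D) (d%:E * b x) <= d%:E * \esum_(x in D) b x)%E.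
  move=> d0 b0; apply: ge_ereal_sup => _ [X [finX XD] <-].
  rewrite -ge0_mule_fsumr// lee_wpmul2l// ereal_sup_ubound//.
  by exists X.
apply/le_anti; rewrite le//=.
have [->|cn0] := eqVneq c 0.
  rewrite mul0e; apply: esum_ge0 => x _; by rewrite mul0e.
have cp : 0 < c by rewrite lt_def cn0.
rewrite -lee_pdivlMl//.
have ca0 x : (0 <= c%:E * a x)%E by rewrite mule_ge0.
apply: le_trans (le c^-1 _ _ ca0); last by rewrite invr_ge0.
by apply: le_esum => x _; rewrite muleA -EFinM mulVf// mul1e.
Qed.

Lemma le_esum_sub D E (a : T -> \bar R) : D `<=` E ->
  (\esum_(x in D) a x <= \esum_(x in E) a x)%E.
Proof.
move=> DE; apply: ge_ereal_sup => _ [X [finX XD] <-].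
by apply: ereal_sup_ubound; exists X => //; split=> // x /XD/DE.
Qed.

Lemma abs_esum_ge0 D f : (0 <= abs_esum D f)%E.
Proof. by apply: esum_ge0 => x _; rewrite lee_fin normc_ge0. Qed.

Lemma abs_esum_fin D f : (abs_esum D f < +oo)%E ->
  (fine (abs_esum D f))%:E = abs_esum D f.
Proof. by move=> f1; rewrite fineK// ge0_fin_numE// abs_esum_ge0. Qed.

Lemma abs_esumD D f g :
  (abs_esum D (fun x => (f x + g x)%R) <= abs_esum D f + abs_esum D g)%E.
Proof.
rewrite -esumD; [|by move=> x _; rewrite lee_fin normc_ge0..].
by apply: le_esum => x _; rewrite -EFinD lee_fin ler_normcD.
Qed.

Lemma abs_esumZ D f (k : R[i]) :
  abs_esum D (fun x => k * f x) = ((normc k)%:E * abs_esum D f)%E.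
Proof.
rewrite -esumZ ?normc_ge0// => [|x]; last by rewrite lee_fin normc_ge0.
by apply: eq_esum => x _; rewrite normcM EFinM.
Qed.

Definition rsummable D p := (\esum_(x in D) `|p x|%:E < +oo)%E.

Lemma rsummable_pos D p : rsummable D p ->
  (\esum_(x in D) (p^\+ x)%:E \is a fin_num)%E.
Proof.
move=> ps; rewrite ge0_fin_numE; last first.
  by apply: esum_ge0 => x _; rewrite lee_fin le_max lexx orbT.
apply: le_lt_trans ps; apply: le_esum => x _.
by rewrite lee_fin /funrpos ge_max ler_norm normr_ge0.
Qed.

Lemma rsummable_neg D p : rsummable D p ->
  (\esum_(x in D) (p^\- x)%:E \is a fin_num)%E.
Proof.
move=> ps; rewrite ge0_fin_numE; last first.
  by apply: esum_ge0 => x _; rewrite lee_fin le_max lexx orbT.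
apply: le_lt_trans ps; apply: le_esum => x _.
by rewrite lee_fin /funrneg ge_max -normrN ler_norm normr_ge0.
Qed.

Lemma rsumB D p q :
  (forall x, 0 <= p x) -> (forall x, 0 <= q x) ->
  (\esum_(x in D) (p x)%:E < +oo)%E -> (\esum_(x in D) (q x)%:E < +oo)%E ->
  rsum D (fun x => p x - q x) =
  fine (\esum_(x in D) (p x)%:E) - fine (\esum_(x in D) (q x)%:E).
Proof.
move=> p0 q0 ps qs; rewrite /rsum.
set r := fun x => p x - q x.
have rs : rsummable D r.
  apply: (@le_lt_trans _ _ (\esum_(x in D) ((p x)%:E + (q x)%:E))%E).
    apply: le_esum => x _; rewrite -EFinD lee_fin.
    by rewrite (le_trans (ler_normB _ _))// !ger0_norm.
  by rewrite esumD//; [exact: lte_add_pinfty|move=> x _; rewrite lee_fin..].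
have pf : (\esum_(x in D) (p x)%:E \is a fin_num)%E.
  by rewrite ge0_fin_numE// esum_ge0// => x _; rewrite lee_fin.
have qf : (\esum_(x in D) (q x)%:E \is a fin_num)%E.
  by rewrite ge0_fin_numE// esum_ge0// => x _; rewrite lee_fin.
have rp := rsummable_pos rs; have rn := rsummable_neg rs.
have rp0 x : 0 <= r^\+ x by rewrite /funrpos le_max lexx orbT.
have rn0 x : 0 <= r^\- x by rewrite /funrneg le_max lexx orbT.
apply/eqP; rewrite subr_eq addrAC eq_sym subr_eq -!fineD//; apply/eqP.
congr fine; rewrite -!esumD; [|by move=> x _; rewrite lee_fin..].
apply: eq_esum => x _; rewrite -!EFinD; congr (_%:E).
by have := rposneg r x; rewrite [in RHS]/r => H; lra.
Qed.

Lemma rsumD D p q : rsummable D p -> rsummable D q ->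
  rsum D (fun x => p x + q x) = rsum D p + rsum D q.
Proof.
move=> ps qs.
have pp0 x : 0 <= p^\+ x by rewrite /funrpos le_max lexx orbT.
have pn0 x : 0 <= p^\- x by rewrite /funrneg le_max lexx orbT.
have qp0 x : 0 <= q^\+ x by rewrite /funrpos le_max lexx orbT.
have qn0 x : 0 <= q^\- x by rewrite /funrneg le_max lexx orbT.
have pp := rsummable_pos ps; have pn := rsummable_neg ps.
have qp := rsummable_pos qs; have qn := rsummable_neg qs.
have Ep : (\esum_(x in D) (p^\+ x + q^\+ x)%:E =
    \esum_(x in D) (p^\+ x)%:E + \esum_(x in D) (q^\+ x)%:E)%E.
  by rewrite -esumD// => x _; rewrite lee_fin.
have En : (\esum_(x in D) (p^\- x + q^\- x)%:E =
    \esum_(x in D) (p^\- x)%:E + \esum_(x in D) (q^\- x)%:E)%E.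
  by rewrite -esumD// => x _; rewrite lee_fin.
have -> : (fun x => p x + q x) =
    (fun x => (p^\+ x + q^\+ x) - (p^\- x + q^\- x)).
  apply/funext => x; have := rposneg p x; have := rposneg q x => *; lra.
rewrite rsumB//.
- by rewrite Ep En !fineD// /rsum; lra.
- by move=> x; rewrite addr_ge0.
- by move=> x; rewrite addr_ge0.
- by rewrite Ep ltey_eq fin_numD pp qp.
- by rewrite En ltey_eq fin_numD pn qn.
Qed.

Lemma rsumN D p : rsum D (fun x => - p x) = - rsum D p.
Proof.
rewrite /rsum opprB; congr (fine _ - fine _); apply: eq_esum => x _.
by rewrite /funrpos /funrneg opprK.
Qed.

Lemma rsumZ D p (k : R) : rsum D (fun x => k * p x) = k * rsum D p.
Proof.
wlog k0 : k / 0 <= k => [H|].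
  have [/H//|kn] := leP 0 k; have := H (- k).
  rewrite oppr_ge0 ltW// => /(_ isT) HN.
  rewrite -[LHS]opprK -rsumN -[RHS]opprK -mulNr -HN; congr (- rsum D _).
  by apply/funext => x; rewrite mulNr.
rewrite /rsum mulrBr.
have E (q : T -> R) : (forall x, 0 <= q x) ->
    k * fine (\esum_(x in D) (q x)%:E) = fine (\esum_(x in D) (k * q x)%:E).
  move=> q0; under [in RHS]eq_esum do rewrite EFinM.
  rewrite esumZ//.
  have [->|kn0] := eqVneq k 0; first by rewrite mul0r mul0e.
  have kp : 0 < k by rewrite lt_def kn0.
  case: (\esum_(x in D) _)%R => [r| |] //=; rewrite mulr0.
    by rewrite gt0_muley ?lte_fin.
  by rewrite gt0_muleNy ?lte_fin.
rewrite !E => [|x|x]; try by rewrite le_max lexx orbT.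
congr (fine _ - fine _); apply: eq_esum => x _; congr (_%:E).
  by rewrite /funrpos maxr_pMr// mulr0.
by rewrite /funrneg maxr_pMr// mulr0 mulrN.
Qed.

Lemma rsum_le D p (M : R) : rsummable D p ->
  (\esum_(x in D) `|p x|%:E <= M%:E)%E -> rsum D p <= M.
Proof.
move=> ps pM; rewrite /rsum lerBlDr -lee_fin EFinD fineK; last exact: rsummable_pos.
have ? := rsummable_neg ps.
rewrite fineK// (@le_trans _ _ M%:E)//.
  apply: le_trans pM; apply: le_esum => x _.
  by rewrite lee_fin /funrpos ge_max ler_norm normr_ge0.
by rewrite leeDl// esum_ge0// => x _; rewrite lee_fin le_max lexx orbT.
Qed.

Lemma summable_Re D f : (abs_esum D f < +oo)%E ->
  rsummable D (fun x => complex.Re (f x)).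
Proof.
by apply: le_lt_trans; apply: le_esum => x _; rewrite lee_fin normc_Re.
Qed.

Lemma summable_Im D f : (abs_esum D f < +oo)%E ->
  rsummable D (fun x => complex.Im (f x)).
Proof.
by apply: le_lt_trans; apply: le_esum => x _; rewrite lee_fin normc_Im.
Qed.

Lemma csumD D f g : (abs_esum D f < +oo)%E -> (abs_esum D g < +oo)%E ->
  csum D (fun x => f x + g x) = csum D f + csum D g.
Proof.
move=> fs gs; rewrite /csum.
have -> : (fun x => complex.Re (f x + g x)) =
    (fun x => complex.Re (f x) + complex.Re (g x)).
  by apply/funext => x; case: (f x) (g x) => [? ?] [? ?].
have -> : (fun x => complex.Im (f x + g x)) =
    (fun x => complex.Im (f x) + complex.Im (g x)).
  by apply/funext => x; case: (f x) (g x) => [? ?] [? ?].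
by rewrite (rsumD (summable_Re fs) (summable_Re gs))
  (rsumD (summable_Im fs) (summable_Im gs)).
Qed.

Lemma rsummableZ D p (k : R) : rsummable D p -> rsummable D (fun x => k * p x).
Proof.
move=> ps; rewrite /rsummable; under eq_esum do rewrite normrM EFinM.
rewrite esumZ//.
by rewrite lte_mul_pinfty// lee_fin.
Qed.

Lemma csumZ D f (k : R[i]) : (abs_esum D f < +oo)%E ->
  csum D (fun x => k * f x) = k * csum D f.
Proof.
move=> fs; rewrite /csum; case: k => a b.
have -> : (fun x => complex.Re ((a +i* b) * f x)) =
    (fun x => a * complex.Re (f x) + (- b) * complex.Im (f x)).
  by apply/funext => x; case: (f x) => c d /=; rewrite mulNr.
have -> : (fun x => complex.Im ((a +i* b) * f x)) =
    (fun x => a * complex.Im (f x) + b * complex.Re (f x)).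
  by apply/funext => x; case: (f x) => c d /=.
have fR := summable_Re fs; have fI := summable_Im fs.
rewrite (rsumD (rsummableZ a fR) (rsummableZ (- b) fI)).
rewrite (rsumD (rsummableZ a fI) (rsummableZ b fR)) !rsumZ.
by rewrite mulNr.
Qed.

Lemma normc_csum D f : (abs_esum D f < +oo)%E ->
  ((normc (csum D f))%:E <= abs_esum D f)%E.
Proof.
move=> fs; set z := csum D f.
have zs := csumZ z^* fs.
have kfs : (abs_esum D (fun x => (z^* * f x)%R) < +oo)%E.
  by rewrite abs_esumZ lte_mul_pinfty// lee_fin normc_ge0.
have nJ : normc z^* = normc z by case: (z) => a b /=; rewrite sqrrN.
have ReE : complex.Re (csum D (fun x => z^* * f x)) = normc z ^+ 2.
  rewrite zs -/z; case: (z) => a b /=.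
  by rewrite sqr_sqrtr ?addr_ge0 ?sqr_ge0// mulNr opprK !expr2.
have H : normc z ^+ 2 <= normc z * fine (abs_esum D f).
  rewrite -ReE [leLHS](_ : _ = rsum D (fun x => complex.Re (z^* * f x)))//.
  apply: rsum_le; first exact: summable_Re.
  rewrite EFinM abs_esum_fin// -nJ -abs_esumZ.
  by apply: le_esum => x _; rewrite lee_fin normc_Re.
rewrite -abs_esum_fin// lee_fin.
have [z0|z0] := eqVneq (normc z) 0.
  by rewrite z0 fine_ge0// abs_esum_ge0.
by rewrite -(ler_pM2l (_ : 0 < normc z)) -?expr2// lt_def z0 normc_ge0.
Qed.

Lemma rsum1 D p (x0 : T) : D x0 -> (forall x, x != x0 -> p x = 0) ->
  rsum D p = p x0.
Proof.
move=> Dx0 p0.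
have E (q : T -> R) : (forall x, 0 <= q x) -> (forall x, x != x0 -> q x = 0) ->
    \esum_(x in D) (q x)%:E = (q x0)%:E.
  move=> q0 qx; rewrite (esumID [set x0]) => [|x _]; last by rewrite lee_fin.
  rewrite [X in (_ + X)%E]esum1 ?adde0 => [|x [_ /= /eqP xx0]]; last by rewrite qx.
  rewrite (_ : D `&` [set x0] = [set x0]); last first.
    by apply/seteqP; split=> [x []|x ->].
  by rewrite esum_set1// lee_fin.
rewrite /rsum !E /=.
- by rewrite rposneg.
- by move=> x; rewrite le_max lexx orbT.
- by move=> x /p0 px; rewrite /funrneg px oppr0 maxxx.
- by move=> x; rewrite le_max lexx orbT.
- by move=> x /p0 px; rewrite /funrpos px maxxx.
Qed.

Lemma csum1 D f (x0 : T) : D x0 -> (forall x, x != x0 -> f x = 0) ->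
  csum D f = f x0.
Proof.
move=> Dx0 f0.
have HR x : x != x0 -> complex.Re (f x) = 0 by move=> /f0 ->.
have HI x : x != x0 -> complex.Im (f x) = 0 by move=> /f0 ->.
by rewrite /csum (rsum1 Dx0 HR) (rsum1 Dx0 HI); case: (f x0).
Qed.

Lemma csum0 D f : (forall x, D x -> f x = 0) -> csum D f = 0.
Proof.
move=> f0.
have E p : (forall x, D x -> p x = 0) -> rsum D p = 0.
  move=> p0; rewrite /rsum !esum1 /= ?subrr// => x /p0 px.
    by rewrite /funrneg px oppr0 maxxx.
  by rewrite /funrpos px maxxx.
by rewrite /csum !E// => x /f0 ->.
Qed.

End AbsoluteSums.

Section Ell1Space.
Context (R : realType) (S : choiceType).
Implicit Types (s t : S) (k : R[i]).

Definition ell1_pred : {pred S -> R[i]^o} :=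
  [pred f : S -> R[i]^o | (abs_esum [set: S] f < +oo)%E].

Record ell1 := Ell1 {
  ell1_fun :> S -> R[i]^o ;
  _ : ell1_fun \in ell1_pred }.

Lemma ell1_predP (f : S -> R[i]^o) :
  reflect (abs_esum [set: S] f < +oo)%E (f \in ell1_pred).
Proof. exact: idP. Qed.

Fact ell1_submod : submod_closed ell1_pred.
Proof.
split=> [|k f g /ell1_predP fs /ell1_predP gs]; apply/ell1_predP.
  by rewrite /abs_esum esum1// => s _; rewrite [_ s](_ : _ = 0)// normc0.
apply: le_lt_trans (abs_esumD _ (fun s => k * f s) g) _.
by rewrite abs_esumZ lte_add_pinfty// lte_mul_pinfty// lee_fin normc_ge0.
Qed.

HB.instance Definition _ := GRing.isSubmodClosed.Build R[i]
  (S -> R[i]^o) ell1_pred ell1_submod.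
HB.instance Definition _ := [isSub for ell1_fun].
HB.instance Definition _ := [Choice of ell1 by <:].
HB.instance Definition _ := [SubChoice_isSubLmodule of ell1 by <:].

Implicit Types f g : ell1.

Lemma ell1P f g : (forall s, f s = g s) -> f = g.
Proof. by move=> fg; apply/val_inj/funext. Qed.

Lemma ell1_summable f : (abs_esum [set: S] f < +oo)%E.
Proof. by case: f => f /= /ell1_predP. Qed.

Definition ell1_norm f : R := fine (abs_esum [set: S] f).

Lemma ell1_normE f : (ell1_norm f)%:E = abs_esum [set: S] f.
Proof. by rewrite abs_esum_fin// ell1_summable. Qed.

Lemma ell1_norm_ge0 f : 0 <= ell1_norm f.
Proof. by rewrite fine_ge0// abs_esum_ge0. Qed.

Lemma ell1_norm_le (h : S -> R[i]^o) (r : R) :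
  (forall X : set S, finite_set X ->
    \sum_(s <- fset_set X) normc (h s) <= r) -> (abs_esum [set: S] h <= r%:E)%E.
Proof.
move=> H; apply: ge_ereal_sup => _ [X [finX _] <-].
by rewrite fsbig_finite// sumEFin lee_fin H.
Qed.

Lemma ell1_norm_ge f (X : set S) : finite_set X ->
  \sum_(s <- fset_set X) normc (f s) <= ell1_norm f.
Proof.
move=> finX; rewrite -lee_fin ell1_normE -sumEFin -fsbig_finite//.
by apply: ereal_sup_ubound; exists X.
Qed.

Lemma ell1_norm_eval f s : normc (f s) <= ell1_norm f.
Proof.
by have := ell1_norm_ge f (finite_set1 s); rewrite fset_set1 big_seq_fset1.
Qed.

Definition ell1_normC f : R[i] := (ell1_norm f)%:C.

Fact ell1_normD f g : ell1_normC (f + g) <= ell1_normC f + ell1_normC g.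
Proof.
rewrite /ell1_normC -rmorphD/= lecR -lee_fin EFinD !ell1_normE.
exact: abs_esumD.
Qed.

Fact ell1_normZ k f : ell1_normC (k *: f) = `|k| * ell1_normC f.
Proof.
rewrite /ell1_normC normcEC -rmorphM/=; congr (_%:C).
by apply: EFin_inj; rewrite EFinM !ell1_normE -abs_esumZ.
Qed.

Fact ell1_normC_eq0 f : ell1_normC f = 0 -> f = 0.
Proof.
move=> /complexI f0; apply: ell1P => s.
apply: eq0_normc; apply/le_anti; rewrite normc_ge0 andbT.
by rewrite (le_trans (ell1_norm_eval _ _))// f0.
Qed.

HB.instance Definition _ := Lmodule_isNormed.Build R[i] ell1
  ell1_normD ell1_normZ ell1_normC_eq0.

Lemma rnorm_ell1 f : rnorm f = ell1_norm f.
Proof. by []. Qed.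

Fact ell1_complete (F : set_system ell1) :
  ProperFilter F -> cauchy F -> cvg F.
Proof.
apply: (@complete_of_evaluations R ell1 S (fun f s => f s) (fun=> 1)).
- by [].
- by move=> f g fg; apply: val_inj.
- by move=> f x; rewrite rnorm_ell1 mul1r ell1_norm_eval.
move=> {}F g f r PF Fg Fr.
have bd : (abs_esum [set: S] (fun s => g s - f s)%R <= r%:E)%E.
  apply: ell1_norm_le => X finX.
  apply/ler_addgt0Pr => e e0.
  pose m := size (fset_set X).
  have d0 : 0 < e / m.+1%:R by rewrite divr_gt0.
  have [|h [hg hf]] := @filter_ex _ F _ (fun h : ell1 =>
      {in enum_fset (fset_set X), forall s, normc (h s - g s) <= e / m.+1%:R} /\
      rnorm (h - f) <= r).
    apply: filterI => //; elim: (enum_fset _) => [|s l IHl]; first exact: nearW.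
    apply: filterS2 (Fg s _ d0) IHl => h hs hl t.
    by rewrite in_cons => /predU1P[->//|]; exact: hl.
  apply: (@le_trans _ _ (\sum_(s <- fset_set X)
      (normc ((h - f) s) + e / m.+1%:R))).
    rewrite big_seq [leRHS]big_seq; apply: ler_sum => s sX.
    have -> : g s - f s = (h - f) s - (h s - g s).
      have E (a b c : R[i]) : a - b = (c - b) - (c - a) by ring.
      exact: E.
    by rewrite (le_trans (ler_normcD _ _))// normcN lerD// hg.
  rewrite big_split/= lerD//; first exact: le_trans (ell1_norm_ge _ finX) hf.
  rewrite big_const_seq count_predT iter_addr_0 -/m -[leLHS]mulr_natr.
  by rewrite mulrAC ler_pdivrMr// ler_wpM2l ?ler_nat// ltW.
have gP : (g : S -> R[i]^o) \in ell1_pred.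
  apply/ell1_predP.
  have -> : g = (fun s => (g s - f s) + f s) by apply/funext => s; rewrite subrK.
  apply: le_lt_trans (abs_esumD _ _ _) _.
  apply: lte_add_pinfty; last exact: ell1_summable.
  exact: le_lt_trans bd (ltry _).
by exists (Ell1 gP) => //; rewrite rnorm_ell1 -lee_fin ell1_normE.
Qed.

HB.instance Definition _ := Uniform_isComplete.Build ell1 ell1_complete.

Fact delta_subproof s :
  ((fun t => (t == s)%:R) : S -> R[i]^o) \in ell1_pred.
Proof.
apply/ell1_predP; rewrite /abs_esum (esumID [set s]) => [|t _]; last first.
  by rewrite lee_fin normc_ge0.
rewrite setTI esum_set1 ?lee_fin ?normc_ge0// esum1 ?adde0 ?ltry//.
by move=> t [_ /eqP/negPf ->]; rewrite normc0.
Qed.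

Definition ell1_basis s : ell1 := Ell1 (delta_subproof s).

Lemma ell1_dense f (e : R) : 0 < e -> exists l : seq S,
  rnorm (f - \sum_(s <- l) f s *: ell1_basis s) <= e.
Proof.
move=> e0.
have : ((ell1_norm f - e)%:E < abs_esum [set: S] f)%E.
  by rewrite -ell1_normE lte_fin ltrBlDr ltrDl.
move=> /ereal_sup_gt[_ [X [finX _] <-] HX]; exists (enum_fset (fset_set X)).
set g := \sum_(s <- _) _.
have gE t : g t = if t \in fset_set X then f t else 0.
  have gtE : g t = \sum_(s <- enum_fset (fset_set X)) f s * (t == s)%:R.
    have E0 : (0 : ell1) t = 0 by [].
    have ED : {morph (fun h : ell1 => h t : R[i]^o) : x y / x + y} by [].
    by rewrite /g (big_morph (fun h : ell1 => h t : R[i]^o) ED E0).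
  rewrite gtE; case: ifPn => tX.
    rewrite (bigD1_seq t)//= ?eqxx ?mulr1 ?fset_uniq// big1 ?addr0// => s.
    by rewrite eq_sym => /negPf ->; rewrite mulr0.
  rewrite big_seq big1// => s sX; case: eqP => [ts|]; last by rewrite mulr0.
  by rewrite ts sX in tX.
rewrite rnorm_ell1 -lee_fin ell1_normE.
have HS : (abs_esum [set: S] f = abs_esum X f + abs_esum (~` X) f)%E.
  rewrite /abs_esum (esumID X) => [|t _]; last by rewrite lee_fin normc_ge0.
  by rewrite !setTI.
have -> : abs_esum [set: S] (f - g) = abs_esum (~` X) f.
  rewrite /abs_esum [RHS]esum_mkcond; apply: eq_esum => t _.
  rewrite [(f - g) t](_ : _ = f t - g t)// gE in_fset_set// in_setC.
  by case: ifP => _ /=; rewrite ?subrr ?subr0 ?normc0.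
have HX' : abs_esum X f = \sum_(x \in X) (normc (f x))%:E.
  by rewrite /abs_esum esum_fset// => t _; rewrite lee_fin normc_ge0.
move: HX; rewrite -HX'.
have := ell1_normE f; rewrite HS.
have := abs_esum_ge0 X f; have := abs_esum_ge0 (~` X) f.
case: (abs_esum X f) => [a| |]; case: (abs_esum (~` X) f) => [b| |] //=.
move=> _ _ [->]; rewrite lte_fin lee_fin; lra.
Qed.

Lemma ell1_ext0 (W : normedModType R[i]) (L : ell1 -> W) (c : R) :
  {morph L : f g / f + g} -> (forall f, rnorm (L f) <= c * rnorm f) ->
  (forall k s, L (k *: ell1_basis s) = 0) -> forall f, L f = 0.
Proof.
move=> LD Lc L0 f; apply/eqP; rewrite -rnorm_eq0; apply/eqP/le_anti.
rewrite rnorm_ge0 andbT; apply/ler_addgt0Pr => e e0; rewrite add0r.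
have d0 : 0 < e / (`|c| + 1) by rewrite divr_gt0// ltr_pwDr.
have [l fl] := ell1_dense f d0.
have L00 : L 0 = 0 by apply: (addrI (L 0)); rewrite -LD !addr0.
have -> : L f = L (f - \sum_(s <- l) f s *: ell1_basis s).
  have Ls : L (\sum_(s <- l) f s *: ell1_basis s) = 0.
    by rewrite (big_morph L LD L00) big1// => s _; rewrite L0.
  by rewrite -[RHS]addr0 -[in RHS]Ls -LD subrK.
rewrite (le_trans (Lc _))// (@le_trans _ _ ((`|c| + 1) * (e / (`|c| + 1))))//.
  rewrite (@le_trans _ _ ((`|c| + 1) * rnorm (f - \sum_(s <- l) f s *: ell1_basis s)))//.
    by rewrite ler_wpM2r ?rnorm_ge0// (le_trans (ler_norm _))// lerDl.
  by rewrite ler_wpM2l// addr_ge0.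
by rewrite mulrCA mulfV ?mulr1// gt_eqF// ltr_pwDr.
Qed.

End Ell1Space.

Section Ell1Algebra.
Context (R : realType) (S : semigroupType).
Local Notation L1 := (ell1 R S).
Implicit Types (s t u : S) (k : R[i]) (f g h : L1).

Definition mul_fiber s : set (S * S) := [set p | (p.1 * p.2)%g = s].

(* (f g)(s) is the sum of f(t) g(u) over the pairs (t, u) with t u = s; see
   convolution_basis for the product of two basis vectors. *)
Definition convolution_fun (f g : S -> R[i]^o) : S -> R[i]^o :=
  fun s => csum (mul_fiber s) (fun p : S * S => (f p.1 : R[i]) * g p.2).

Lemma esum_fiber (a : S * S -> \bar R) : (forall p, (0 <= a p)%E) ->
  \esum_(s in [set: S]) \esum_(p in mul_fiber s) a p = \esum_(p in [set: S * S]) a p.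
Proof.
move=> a0; rewrite esum_esum//.
rewrite (reindex_esum [set: S * S] _ (fun p => ((p.1 * p.2)%g, p)))//; split.
- by move=> p _.
- by move=> p q _ _ [].
- by move=> [s p] [_ /= <-]; exists p.
Qed.

Lemma abs_esum_pair f g :
  abs_esum [set: S * S] (fun p : S * S => (f p.1 : R[i]) * g p.2) =
  ((ell1_norm f)%:E * (ell1_norm g)%:E)%E.
Proof.
have -> : [set: S * S] = [set: S] `*`` (fun=> [set: S]).
  by apply/seteqP; split.
rewrite /abs_esum -(@esum_esum _ _ _ _ _
  (fun s t => (normc ((f s : R[i]) * g t))%:E)); last first.
  by move=> s t _ _; rewrite lee_fin normc_ge0.
under eq_esum => s _.
  have -> : \esum_(t in [set: S]) (normc ((f s : R[i]) * g t))%:E =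
      ((normc (f s))%:E * (ell1_norm g)%:E)%E.
    by rewrite ell1_normE -abs_esumZ.
  rewrite muleC.
  over.
rewrite esumZ ?ell1_norm_ge0// => [|s]; last by rewrite lee_fin normc_ge0.
by rewrite muleC; congr (_ * _)%E; rewrite ell1_normE.
Qed.

Lemma conv_summable f g s :
  (abs_esum (mul_fiber s) (fun p : S * S => ((f p.1 : R[i]) * g p.2)%R) < +oo)%E.
Proof.
apply: (@le_lt_trans _ _ (abs_esum [set: S * S]
  (fun p : S * S => (f p.1 : R[i]) * g p.2))).
  exact: le_esum_sub.
by rewrite abs_esum_pair -EFinM ltry.
Qed.

Lemma conv_norm f g :
  (abs_esum [set: S] (convolution_fun f g) <= (ell1_norm f * ell1_norm g)%:E)%E.
Proof.
rewrite EFinM -abs_esum_pair /abs_esum -esum_fiber => [|p]; last first.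
  by rewrite lee_fin normc_ge0.
by apply: le_esum => s _; apply: normc_csum; exact: conv_summable.
Qed.

Fact conv_subproof f g : convolution_fun f g \in @ell1_pred R S.
Proof. by apply/ell1_predP; rewrite (le_lt_trans (conv_norm _ _))// ltry. Qed.

Definition convolution f g : L1 := Ell1 (conv_subproof f g).

Lemma rnorm_conv f g : rnorm (convolution f g) <= rnorm f * rnorm g.
Proof. by rewrite !rnorm_ell1 -lee_fin ell1_normE conv_norm. Qed.

Fact ler_norm_conv f g : `|convolution f g| <= `|f| * `|g|.
Proof. by rewrite -!rnormE -rmorphM/= lecR rnorm_conv. Qed.

Fact convDl : left_distributive convolution +%R.
Proof.
move=> f g h; apply: ell1P => s.
rewrite [RHS](_ : _ = convolution f h s + convolution g h s)// /= /convolution_fun.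
rewrite -csumD; [|exact: conv_summable..].
by congr csum; apply/funext => p; rewrite -mulrDl.
Qed.

Fact convDr : right_distributive convolution +%R.
Proof.
move=> f g h; apply: ell1P => s.
rewrite [RHS](_ : _ = convolution f g s + convolution f h s)// /= /convolution_fun.
rewrite -csumD; [|exact: conv_summable..].
by congr csum; apply/funext => p; rewrite -mulrDr.
Qed.

Fact convZl k f g : convolution (k *: f) g = k *: convolution f g.
Proof.
apply: ell1P => s; rewrite [RHS](_ : _ = k * convolution f g s)// /= /convolution_fun.
rewrite -csumZ; last exact: conv_summable.
by congr csum; apply/funext => p; rewrite mulrA.
Qed.

Fact convZr k f g : convolution f (k *: g) = k *: convolution f g.
Proof.
apply: ell1P => s; rewrite [RHS](_ : _ = k * convolution f g s)// /= /convolution_fun.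
rewrite -csumZ; last exact: conv_summable.
by congr csum; apply/funext => p; rewrite mulrCA.
Qed.

Lemma convolution_basis s t : convolution (ell1_basis R s) (ell1_basis R t) = ell1_basis R (s * t)%g.
Proof.
apply: ell1P => u; rewrite /= /convolution_fun.
have [->|ust] := eqVneq u (s * t)%g.
  rewrite (@csum1 _ _ _ _ (s, t))//= ?eqxx ?mulr1// => -[s' t'].
  rewrite xpair_eqE negb_and /= => /orP[/negPf->|/negPf->].
    by rewrite mul0r.
  by rewrite mulr0.
apply: csum0 => -[s' t'] /= st'.
have [s's|] := eqVneq s' s; last by rewrite mul0r.
have [t't|] := eqVneq t' t; last by rewrite mulr0.
by move: ust; rewrite -st' s's t't eqxx.
Qed.

Let assoc f g h : L1 := convolution f (convolution g h) - convolution (convolution f g) h.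

Let assoc_le f g h : rnorm (assoc f g h) <= 2 * (rnorm f * rnorm g * rnorm h).
Proof.
rewrite -lecR rnormE (le_trans (ler_normB _ _))// -!rnormE -rmorphD/= lecR.
rewrite mulr_natl mulr2n lerD//.
  rewrite (le_trans (rnorm_conv _ _))// -mulrA ler_wpM2l ?rnorm_ge0//.
  exact: rnorm_conv.
rewrite (le_trans (rnorm_conv _ _))// ler_wpM2r ?rnorm_ge0//.
exact: rnorm_conv.
Qed.

Fact convA : associative convolution.
Proof.
suff H f g h : assoc f g h = 0 by move=> f g h; exact/subr0_eq/H.
have E (x y z w : L1) : (x + y) - (z + w) = (x - z) + (y - w).
  by rewrite opprD addrACA.
apply: (@ell1_ext0 R S L1 (fun f => assoc f g h) (2 * (rnorm g * rnorm h))).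
- by move=> x y; rewrite /assoc !convDl E.
- by move=> x; rewrite (le_trans (assoc_le _ _ _))// -!mulrA [rnorm x * _]mulrC
    -!mulrA.
move=> k s {f}; rewrite /assoc !convZl -scalerBr -/(assoc _ g h).
apply/eqP; rewrite scaler_eq0; apply/orP; right; apply/eqP.
apply: (@ell1_ext0 R S L1 (fun g => assoc (ell1_basis R s) g h)
  (2 * (rnorm (ell1_basis R s) * rnorm h))).
- by move=> x y; rewrite /assoc !(convDl, convDr) E.
- move=> x; rewrite (le_trans (assoc_le _ _ _))// -!mulrA.
  by rewrite [rnorm h * _]mulrC.
move=> {}k t {g}; rewrite /assoc !(convZl, convZr) -scalerBr -/(assoc _ _ h).
apply/eqP; rewrite scaler_eq0; apply/orP; right; apply/eqP.
apply: (@ell1_ext0 R S L1 (fun h => assoc (ell1_basis R s) (ell1_basis R t) h)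
  (2 * (rnorm (ell1_basis R s) * rnorm (ell1_basis R t)))).
- by move=> x y; rewrite /assoc !convDr E.
- by move=> x; rewrite (le_trans (assoc_le _ _ _))// !mulrA.
move=> {}k u {h}; rewrite /assoc !(convZl, convZr) -scalerBr.
by rewrite !convolution_basis mulgA subrr scaler0.
Qed.

HB.instance Definition _ := isBanachAlgebra.Build R[i] L1
  convA convDl convDr convZl convZr ler_norm_conv.

End Ell1Algebra.

Definition is_semilattice (S : semigroupType) : Prop :=
  (forall s t : S, s * t = t * s)%g /\ (forall s : S, s * s = s)%g.

Definition is_unital (S : semigroupType) : Prop :=
  exists e : S, forall s : S, (e * s = s)%g /\ (s * e = s)%g.

(* Main.v *)
Require Import Defs.
From mathcomp Require Import all_boot all_order all_algebra complex.
From mathcomp Require Import all_classical all_reals all_analysis.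
From mathcomp Require Import ring zify.

(** A bounded n-cochain with values in the dual of ell^1(S) is the same thing
as a bounded function psi on S^(n+1), through
psi(x_0, ..., x_n) = F(e_(x_1), ..., e_(x_n))(e_(x_0)), and the Hochschild
coboundary becomes the alternating sum over the faces of the cyclic bar
construction of S: multiply two neighbours, or the last entry into the first.
So the task is to find, for each bounded psi killed by this [codiff], a bounded
phi with codiff phi = psi.

If S is generated by a finite list l of commuting idempotents, its semigroup
algebra contains the separability idempotent
Delta_l = prod_(e in l) (e (x) e + (1 - e) (x) (1 - e)):
it satisfies c Delta_l = Delta_l c for c in the submonoid generated by l, and
its two tensor factors multiply to 1. Inserting Delta_l between x_0 and x_1
([insert_diag]) is a contracting homotopy ([insert_diag_codiff]), but its norm,
at most 5^(size l), grows with l, and no finite l serves an infinite S.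

Acyclic models remove the dependence on S. A tuple x = (x_0, ..., x_n) is the
image of the tuple of generators of the free unital semilattice on n+1 letters,
so it suffices to contract x inside the submonoid generated by its own entries,
where Delta_l with l = [x_0; ...; x_n] is available. Since a different Delta_l
is used for each x, the resulting maps must be corrected degree by degree: if h
is a homotopy already constructed in lower degrees, the chain x - h(d x) is a
cycle, and h(x) is defined as Delta_l inserted in this cycle. The dual of this
recursion is [homotopy], and [homotopyP] is the homotopy identity. The list l
has n+1 entries whatever S is, so the bound of [homotopy_bound] depends on n
only.

There remains to pass between functions on S^(n+1) and cochains. A bounded
function extends to a bounded multilinear form by iterated absolutely convergent
summation ([extend], [exists_cochain]), and a bounded multilinear map is
determined by its values on basis vectors ([cochain_basis_eq0]). *)

Set Implicit Arguments.
Unset Strict Implicit.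
Unset Printing Implicit Defensive.

Import Order.TTheory GRing.Theory Num.Theory ComplexField.Normc.

Local Open Scope classical_set_scope.
Local Open Scope ring_scope.
Local Open Scope complex_scope.
Local Open Scope banach_scope.

(** * Sequences *)

Definition scons (T : Type) (a : T) (x : nat -> T) : nat -> T :=
  fun k => if k is k'.+1 then x k' else a.

Lemma sconsE (T : Type) (x : nat -> T) : scons (x 0) (fun k => x k.+1) = x.
Proof. by apply/funext => -[]. Qed.

Definition update (T : Type) (x : nat -> T) (i : nat) (a : T) : nat -> T :=
  fun k => if k == i then a else x k.

Lemma scons_update0 (T : Type) (x : nat -> T) (a b : T) :
  scons b x = update (scons a x) 0 b.
Proof. by apply/funext => -[|k]. Qed.

Lemma scons_updateS (T : Type) (x : nat -> T) i (a b : T) :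
  scons b (update x i a) = update (scons b x) i.+1 a.
Proof. by apply/funext => -[|k]. Qed.

Definition pad (T : Type) (d : T) n (v : 'I_n -> T) : nat -> T :=
  fun k => oapp v d (insub k).

Lemma pad_ord (T : Type) (d : T) n (v : 'I_n -> T) (i : 'I_n) : pad d v i = v i.
Proof. by rewrite /pad valK. Qed.

Lemma pad_ge (T : Type) (d : T) n (v : 'I_n -> T) k : (n <= k)%N -> pad d v k = d.
Proof. by move=> nk; rewrite /pad insubF // ltnNge nk. Qed.

Lemma pad_set_arg (K : numFieldType) (A : completeNormedModType K) (d : A) n
    (v : 'I_n -> A) (i : 'I_n) (a : A) :
  pad d (set_arg v i a) = update (pad d v) i a.
Proof.
apply/funext => k; rewrite /update; have [kn|nk] := ltnP k n.
  by rewrite -[k]/(val (Ordinal kn)) !pad_ord /set_arg.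
rewrite !pad_ge //; case: eqP => // ki.
by move: nk; rewrite ki leqNgt ltn_ord.
Qed.

(** * Faces of the cyclic bar construction *)

(** The cancellation behind d d = 0 for any family of maps with the simplicial
identities: the (i, j) term with i <= j is opposite to the (j+1, i) term.
Passing from N to N+1 adds the column j = N and the row i = N+1, which cancel
each other entry by entry. *)
Lemma alternating_sum_cancel (K : nzRingType) N (f : nat -> nat -> K) :
  (forall i j, (i <= j)%N -> (j < N)%N -> f i j = f j.+1 i) ->
  \sum_(i < N.+1) \sum_(j < N) (-1) ^+ (i + j) * f i j = 0.
Proof.
elim: N => [|N IH] ff; first by rewrite big1 // => i _; rewrite big_ord0.
rewrite big_ord_recr /=.
under eq_bigr do rewrite big_ord_recr /=.
rewrite big_split /= IH ?add0r; last by move=> i j ij jN; rewrite ff // ltnW.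
rewrite -big_split big1 //= => i _.
rewrite (ff i N) // -1?ltnS // addnC addSn exprS mulN1r mulNr; exact: addrN.
Qed.

Section Faces.
Variable S : semigroupType.
Hypothesis mulC : forall s t : S, (s * t = t * s)%g.
Implicit Types (x : nat -> S).

(** An (n+1)-tuple is stored in positions 0, ..., n of an infinite sequence, so
that all degrees share one type of cochains and no cast between tuple types
occurs. Every face removes an entry and shifts all later ones, positions beyond
n included; this makes the simplicial identities hold for whole sequences. The
entry at q > p is removed and multiplied into the one at p. *)
Definition merge_at (p q : nat) x : nat -> S :=
  fun k => if k == p then (x p * x q)%g else x (bump q k).

(** For i < N this multiplies entries i and i+1; for i = N it is the cyclic face,
which multiplies the last entry x_N into x_0. *)
Definition face N i x : nat -> S :=
  if (i < N)%N then merge_at i i.+1 x else merge_at 0 N x.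

(** The simplicial identities. Those that involve the cyclic face need
commutativity, because three entries may be merged in two different orders. *)
Lemma face_face n i j x : (i <= j <= n.+1)%N ->
  face n.+1 j (face n.+2 i x) = face n.+1 i (face n.+2 j.+1 x).
Proof.
move=> /andP[ij jn]; apply/funext => k; rewrite /face.
have eqx a b : a = b -> x a = x b by move=> ->.
have -> : (i < n.+2)%N by lia.
have [jn1|jn1] := ltnP j n.+1.
  have -> : (i < n.+1)%N by lia.
  have -> : (j.+1 < n.+2)%N by lia.
  rewrite /merge_at /bump.
  repeat (case: eqP => ? //); subst; rewrite ?mulgA;
   try (by exfalso; lia); try (by apply: eqx; lia);
   try (congr (_ * _)%g; try congr (_ * _)%g; apply: eqx; lia).
have {jn jn1} jE : j = n.+1 by lia.
subst j; rewrite ltnn.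
have [|] := ltnP i n.+1; rewrite /merge_at /bump => ?.
  repeat (case: eqP => ? //); subst; rewrite ?mulgA;
   try (by exfalso; lia); try (by apply: eqx; lia);
   try (by congr (_ * _)%g; apply: eqx; lia).
  rewrite -!mulgA; congr (_ * _)%g.
  by rewrite mulC; congr (_ * _)%g; apply: eqx; lia.
have -> : i = n.+1 by lia.
repeat (case: eqP => ? //); subst; rewrite ?mulgA;
 try (by exfalso; lia); try (by apply: eqx; lia);
 try (by congr (_ * _)%g; apply: eqx; lia).
rewrite -!mulgA; congr (_ * _)%g.
by rewrite mulC; congr (_ * _)%g; apply: eqx; lia.
Qed.

Lemma face_closed (Q : S -> Prop) n i x :
  (forall s t, Q s -> Q t -> Q (s * t)%g) -> (i <= n.+1)%N ->
  (forall k, (k <= n.+1)%N -> Q (x k)) ->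
  forall k, (k <= n)%N -> Q (face n.+1 i x k).
Proof.
move=> Qmul il Qx k kn; rewrite /face /merge_at /bump.
by repeat case: ifP => ?; try apply: Qmul; apply: Qx; lia.
Qed.

End Faces.

(** * The separability idempotent of finitely many idempotents *)

Section Separate.
Variables (S : semigroupType) (K : numDomainType).
Hypothesis mulC : forall s t : S, (s * t = t * s)%g.
Hypothesis mulss : forall s : S, (s * s = s)%g.
Implicit Types (l : seq S) (g : S -> S -> K).

(** The coefficients are those of
e (x) e + (1 - e) (x) (1 - e) = 2 e (x) e + 1 (x) 1 - e (x) 1 - 1 (x) e,
acting by multiplication on the two variables of g. *)
Definition separate_step (e : S) g : S -> S -> K := fun a b =>
  g (e * a)%g (e * b)%g *+ 2 + g a b - g (e * a)%g b - g a (e * b)%g.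

Definition separate l g : S -> S -> K := foldr separate_step g l.

Lemma separate_sum l n (c : 'I_n -> K) (g : 'I_n -> S -> S -> K) a b :
  separate l (fun a b => \sum_i c i * g i a b) a b =
  \sum_i c i * separate l (g i) a b.
Proof.
elim: l a b => [//|e l IH] a b /=; rewrite {1}/separate_step.
rewrite !IH -sumrMnl -!(big_split, sumrB) /=.
by apply: eq_bigr => i _; rewrite /separate_step; ring.
Qed.

Lemma separate_mull l c g a b :
  separate l (fun a b => g (c * a)%g b) a b = separate l g (c * a)%g b.
Proof.
elim: l a b => [//|e l IH] a b /=; rewrite /separate_step !IH.
by rewrite !mulgA (mulC e c).
Qed.

Lemma separate_mulr l c g a b :
  separate l (fun a b => g a (c * b)%g) a b = separate l g a (c * b)%g.
Proof.
elim: l a b => [//|e l IH] a b /=; rewrite /separate_step !IH.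
by rewrite !mulgA (mulC e c).
Qed.

(** The factors of the separability idempotent multiply to 1: one step of the
product replaces k(ab) by 2k(eab) + k(ab) - k(eab) - k(eab). *)
Lemma separate_prod l (k : S -> K) a b :
  separate l (fun a b => k (a * b)%g) a b = k (a * b)%g.
Proof.
elim: l a b => [//|e l IH] a b /=; rewrite /separate_step !IH.
have -> : (e * a * (e * b) = e * (a * b))%g.
  by rewrite mulgA -(mulgA e a e) (mulC a e) (mulgA e e a) mulss -mulgA.
rewrite (mulgA a e) (mulC a e) -mulgA; ring.
Qed.

(** c Delta_l = Delta_l c in the semigroup algebra, tested against functions
of two variables. *)
Definition balanced l (c : S) : Prop :=
  forall g a b, separate l g (c * a)%g b = separate l g a (c * b)%g.

Lemma balanced_mul l s t : balanced l s -> balanced l t -> balanced l (s * t)%g.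
Proof. by move=> ls lt g a b; rewrite -!mulgA ls lt !mulgA (mulC s). Qed.

Lemma balanced_one l one : (forall s, one * s = s)%g -> balanced l one.
Proof. by move=> one1 g a b; rewrite !one1. Qed.

(** Multiplying e (x) e + (1 - e) (x) (1 - e) by e on either side leaves e (x) e,
and the factors of Delta_l commute. *)
Lemma balanced_mem l c : c \in l -> balanced l c.
Proof.
elim: l => [//|e l IH]; rewrite inE => /predU1P[->|/IH lc] g a b /=.
  rewrite /separate_step !mulgA mulss; ring.
by rewrite /separate_step !mulgA (mulC e c) -!mulgA !lc.
Qed.

Lemma separate_local (Q : S -> Prop) l g h :
  (forall s t, Q s -> Q t -> Q (s * t)%g) -> {in l, forall s, Q s} ->
  (forall a b, Q a -> Q b -> g a b = h a b) ->
  forall a b, Q a -> Q b -> separate l g a b = separate l h a b.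
Proof.
move=> Qmul; elim: l => [//|e l IH] Ql gh a b Qa Qb /=.
have Qe : Q e by apply: Ql; rewrite mem_head.
rewrite /separate_step !IH //; try exact: Qmul;
  by move=> s sl; apply: Ql; rewrite inE sl orbT.
Qed.

Lemma separate_bound l g (c : K) : (forall a b, `|g a b| <= c) ->
  forall a b, `|separate l g a b| <= 5 ^+ size l * c.
Proof.
move=> gc; elim: l => [|e l IH] a b /=; first by rewrite mul1r.
rewrite /separate_step.
rewrite (le_trans (ler_normB _ _)) //.
rewrite (le_trans (lerD (ler_normB _ _) (lexx _))) //.
rewrite (le_trans (lerD (lerD (ler_normD _ _) (lexx _)) (lexx _))) //.
rewrite normrMn.
have -> : 5 ^+ (size l).+1 * c = 5 ^+ size l * c *+ 2 + 5 ^+ size l * c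
   + 5 ^+ size l * c + 5 ^+ size l * c by rewrite exprS; ring.
by rewrite !lerD // lerMn2r IH orbT.
Qed.

End Separate.

(** * A contracting homotopy with bounds independent of the semilattice *)

Section Homotopy.
Variables (S : semigroupType) (K : numDomainType) (one : S).
Hypothesis mulC : forall s t : S, (s * t = t * s)%g.
Hypothesis mulss : forall s : S, (s * s = s)%g.
Hypothesis mul1 : forall s : S, (one * s = s)%g.
Implicit Types (l : seq S) (x : nat -> S) (psi : (nat -> S) -> K).

Definition codiff n psi x : K := \sum_(i < n.+2) (-1) ^+ i * psi (face n.+1 i x).

Lemma codiff_codiff n psi x : codiff n.+1 (codiff n psi) x = 0.
Proof.
rewrite /codiff.
rewrite -[RHS](@alternating_sum_cancel _ n.+2
  (fun i j => psi (face n.+1 j (face n.+2 i x)))).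
  apply: eq_bigr => i _; rewrite mulr_sumr; apply: eq_bigr => j _.
  by rewrite mulrA exprD.
by move=> i j ij jn; rewrite face_face // ij.
Qed.

Lemma codiffB n psi chi x :
  codiff n (fun y => psi y - chi y) x = codiff n psi x - codiff n chi x.
Proof. by rewrite /codiff -sumrB; apply: eq_bigr => i _; rewrite mulrBr. Qed.

(** Both faces of (x_0, x_1) equal x_0 x_1, by commutativity. This is what starts
the recursion: in degree 1 every chain is a cycle. *)
Lemma codiff0 psi x : codiff 0 psi x = 0.
Proof.
rewrite /codiff !big_ord_recl big_ord0 /= /face /= expr0 mul1r expr1 mulN1r addr0.
exact: subrr.
Qed.

(** Delta_l is inserted between x_0 and x_1: its left factor multiplies x_0 and
its right factor becomes a new entry. *)
Definition insert_diag l psi x : K :=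
  separate l (fun a b => psi (scons a (scons b (fun k => x k.+1)))) (x 0) one.

Lemma insert_diagB l psi chi x :
  insert_diag l (fun y => psi y - chi y) x = insert_diag l psi x - insert_diag l chi x.
Proof.
rewrite /insert_diag; elim: l (x 0) one => [//|e l IH] a b /=.
rewrite /separate_step !IH; ring.
Qed.

(** Face 0 of the tuple with Delta_l inserted gives x back since the two factors
of Delta_l multiply to 1. Every other face i+1 is the insertion of Delta_l in
face i of x; for i = 0 this means moving x_1 through Delta_l, the only place
where [balanced] is used. *)
Lemma insert_diag_codiff l n psi x : balanced K l (x 1%N) ->
  insert_diag l (codiff n.+1 psi) x = psi x - codiff n (insert_diag l psi) x.
Proof.
move=> lx1; rewrite /insert_diag /codiff separate_sum big_ord_recl -sumrN /=.
congr (_ + _).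
  rewrite expr0 mul1r (_ : (fun a b => _) = (fun a b : S =>
    psi (scons (a * b)%g (fun k => x k.+1)))); last first.
    apply/funext => a; apply/funext => b; congr psi.
    by apply/funext => -[|k].
  rewrite (separate_prod mulC mulss l (fun s => psi (scons s _))).
  by rewrite (mulC _ one) mul1 sconsE.
apply: eq_bigr => i _; rewrite /bump leq0n add1n exprS mulN1r mulNr.
congr (- (_ * _)).
have := ltn_ord i; move: (nat_of_ord i) => {}i; rewrite ltnS => il.
have [i0|i0] := posnP i.
  subst i.
  have -> : (fun a b => psi (face n.+2 1 (scons a (scons b (fun k => x k.+1))))) =
     (fun a b => psi (scons a (scons (x 1%N * b)%g (fun k => x k.+2)))).
    apply/funext => a; apply/funext => b; congr psi.
    rewrite /face /merge_at /=.
    by apply/funext => -[|[|k]] //=; rewrite mulC.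
  rewrite (separate_mulr mulC l _ (fun a b => psi (scons a (scons b _)))) -lx1.
  by rewrite mulC.
have [iln|iln] := ltnP i n.+1.
  have -> : (fun a b => psi (face n.+2 i.+1 (scons a (scons b (fun k => x k.+1))))) =
     (fun a b => psi (scons a (scons b (fun k => face n.+1 i x k.+1)))).
    apply/funext => a; apply/funext => b; congr psi.
    rewrite /face ltnS iln /merge_at.
    case: i i0 {il} iln => // i _ il.
    apply/funext => -[|[|k]] //=; rewrite eqSS.
    by case: ifP => // _; rewrite !bumpS.
  congr separate; rewrite /face iln /merge_at; case: i i0 {il iln} => //.
have {il i0 iln} -> : i = n.+1 by lia.
have -> : (fun a b => psi (face n.+2 n.+2 (scons a (scons b (fun k => x k.+1))))) =
     (fun a b => psi (scons (x n.+1 * a)%g (scons b (fun k => face n.+1 n.+1 x k.+1)))).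
  apply/funext => a; apply/funext => b; congr psi.
  rewrite /face ltnn /merge_at.
  by apply/funext => -[|[|k]] //=; rewrite ltnn !bumpS.
rewrite (separate_mull mulC l _ (fun a b => psi (scons a (scons b _)))).
by rewrite {3}/face ltnn /merge_at /= mulC.
Qed.

(** The dual of the recursion that defines h(x), for x = (x_0, ..., x_m), as
Delta_l inserted in x - h(d x), where l = [x_0; ...; x_m]. *)
Fixpoint homotopy m psi x : K :=
  if m is m'.+1 then
    let l := mkseq x m'.+2 in
    insert_diag l psi x - codiff m' (homotopy m' (insert_diag l psi)) x
  else 0.

(** The next three lemmas say that the constructions evaluate their argument only
on tuples in a submonoid that contains x. They are needed because the identity
of [insert_diag_codiff] for the list of entries of x holds only on such
tuples. *)
Lemma codiff_local (Q : S -> Prop) n psi chi :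
  (forall s t, Q s -> Q t -> Q (s * t)%g) ->
  (forall x, (forall k, (k <= n)%N -> Q (x k)) -> psi x = chi x) ->
  forall x, (forall k, (k <= n.+1)%N -> Q (x k)) -> codiff n psi x = codiff n chi x.
Proof.
move=> Qmul pc x Qx; apply: eq_bigr => i _; congr (_ * _).
by apply: pc; apply: face_closed => //; exact: leq_ord.
Qed.

Lemma insert_diag_local (Q : S -> Prop) n l psi chi :
  (forall s t, Q s -> Q t -> Q (s * t)%g) -> Q one -> {in l, forall s, Q s} ->
  (forall x, (forall k, (k <= n.+1)%N -> Q (x k)) -> psi x = chi x) ->
  forall x, (forall k, (k <= n)%N -> Q (x k)) -> insert_diag l psi x = insert_diag l chi x.
Proof.
move=> Qmul Q1 Ql pc x Qx; apply: (separate_local Qmul Ql); last by [].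
  move=> a b Qa Qb; apply: pc => -[//|[//|k]] kn /=; exact: Qx.
exact: Qx.
Qed.

Lemma homotopy_local (Q : S -> Prop) m psi chi :
  (forall s t, Q s -> Q t -> Q (s * t)%g) -> Q one ->
  (forall x, (forall k, (k <= m.+1)%N -> Q (x k)) -> psi x = chi x) ->
  forall x, (forall k, (k <= m)%N -> Q (x k)) -> homotopy m psi x = homotopy m chi x.
Proof.
move=> Qmul Q1; elim: m psi chi => [//|m IH] psi chi pc x Qx /=.
have Ql : {in mkseq x m.+2, forall s, Q s}.
  by move=> s /mapP[k]; rewrite mem_iota => /andP[_ km] ->; apply: Qx.
have pcl := insert_diag_local Qmul Q1 Ql pc.
by rewrite pcl //; congr (_ - _); apply: (codiff_local Qmul (IH _ _ pcl)).
Qed.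

Lemma homotopyB m psi chi x :
  homotopy m (fun y => psi y - chi y) x = homotopy m psi x - homotopy m chi x.
Proof.
elim: m psi chi x => [|m IH] psi chi x; first by rewrite /= subr0.
have E (l : seq S) (f g : (nat -> S) -> K) :
    homotopy m (insert_diag l (fun y => f y - g y)) =
    fun y => homotopy m (insert_diag l f) y - homotopy m (insert_diag l g) y.
  rewrite (_ : insert_diag l _ = fun y => insert_diag l f y - insert_diag l g y).
    by apply/funext => y; exact: IH.
  by apply/funext => y; exact: insert_diagB.
rewrite /= -/(mkseq x m.+2) E codiffB insert_diagB; ring.
Qed.

(** With sigma the insertion of Delta_l, where l lists the entries of x,
sigma (codiff psi) agrees with psi - codiff (sigma psi) on tuples in the
submonoid generated by these entries. The recursion applied to it, the induction hypothesis for sigma psi and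
codiff (codiff _) = 0 make all terms with sigma psi cancel. *)
Lemma homotopyP m psi x :
  homotopy m.+1 (codiff m.+1 psi) x = psi x - codiff m (homotopy m psi) x.
Proof.
elim: m psi x => [|m IH] psi x.
  rewrite /= !codiff0 !subr0 insert_diag_codiff ?codiff0 ?subr0 //.
  by apply: (balanced_mem mulC mulss); rewrite !inE eqxx orbT.
rewrite [LHS](_ : _ = insert_diag (mkseq x m.+3) (codiff m.+2 psi) x -
  codiff m.+1 (homotopy m.+1 (insert_diag (mkseq x m.+3) (codiff m.+2 psi))) x) //.
set l := mkseq x m.+3.
have lx k : (k <= m.+2)%N -> balanced K l (x k).
  by move=> km; apply: (balanced_mem mulC mulss); rewrite map_f // mem_iota.
have bmul := @balanced_mul S K mulC l.
have b1 : balanced K l one by exact: balanced_one.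
rewrite insert_diag_codiff; last exact: lx.
have loc y : (forall k, (k <= m.+1)%N -> balanced K l (y k)) ->
    homotopy m.+1 (insert_diag l (codiff m.+2 psi)) y =
    homotopy m.+1 (fun z => psi z - codiff m.+1 (insert_diag l psi) z) y.
  apply: (homotopy_local bmul b1) => z Qz; apply: insert_diag_codiff; exact: Qz.
rewrite (codiff_local bmul loc lx).
rewrite (_ : homotopy m.+1 _ = fun y => homotopy m.+1 psi y -
    (insert_diag l psi y - codiff m (homotopy m (insert_diag l psi)) y)); last first.
  by apply/funext => y; rewrite homotopyB IH.
rewrite !codiffB codiff_codiff; ring.
Qed.

Lemma codiff_bound n psi (c : K) : (forall x, `|psi x| <= c) ->
  forall x, `|codiff n psi x| <= n.+2%:R * c.
Proof.
move=> pc x; rewrite (le_trans (ler_norm_sum _ _ _)) //.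
rewrite (le_trans (ler_sum _ (G := fun=> c) _)) //.
  by move=> i _; rewrite normrM normrX normrN1 expr1n mul1r.
by rewrite sumr_const card_ord mulr_natl.
Qed.

Lemma homotopy_bound m : exists C : K, forall psi (c : K),
  (forall x, `|psi x| <= c) -> forall x, `|homotopy m psi x| <= C * c.
Proof.
elim: m => [|m [C HC]]; first by exists 0 => psi c _ x; rewrite normr0 mul0r.
exists (5 ^+ m.+2 + m.+2%:R * (C * 5 ^+ m.+2)) => psi c pc x.
have -> : homotopy m.+1 psi x = insert_diag (mkseq x m.+2) psi x -
  codiff m (homotopy m (insert_diag (mkseq x m.+2) psi)) x by [].
have lb : forall y, `|insert_diag (mkseq x m.+2) psi y| <= 5 ^+ m.+2 * c.
  move=> y; rewrite -[X in 5 ^+ X](size_mkseq x m.+2).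
  by apply: separate_bound => a b; exact: pc.
rewrite (le_trans (ler_normB _ _)) // mulrDl lerD //.
rewrite -2!mulrA; apply: codiff_bound; exact: (HC _ _ lb).
Qed.

Lemma exists_primitive m psi (c : K) :
  (forall x, `|psi x| <= c) -> (forall x, codiff m.+1 psi x = 0) ->
  exists phi : (nat -> S) -> K, (exists d, forall x, `|phi x| <= d) /\
    forall x, codiff m phi x = psi x.
Proof.
move=> pc dpsi; have [C HC] := homotopy_bound m.
exists (homotopy m psi); split; first by exists (C * c); exact: HC.
move=> x; apply/esym/subr0_eq; rewrite -homotopyP.
have -> : codiff m.+1 psi = fun y => psi y - psi y.
  by apply/funext => y; rewrite dpsi subrr.
by rewrite homotopyB subrr.
Qed.

End Homotopy.

(** * Multilinear extension of bounded functions on the basis *)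

Section Extension.
Variables (R : realType) (S : choiceType) (one : S).
Local Notation L1 := (ell1 R S).
Implicit Types (f : L1) (a : nat -> L1) (phi : (nat -> S) -> R[i]) (x : nat -> S).

Lemma rnorm_basis (s : S) : rnorm (ell1_basis R s) = 1.
Proof.
rewrite rnorm_ell1; apply: EFin_inj; rewrite ell1_normE /abs_esum.
rewrite (esumID [set s]) => [|t _]; last by rewrite lee_fin normc_ge0.
rewrite setTI esum_set1 ?lee_fin ?normc_ge0// esum1 ?adde0 /= ?eqxx.
  by congr (_%:E); exact: (normc_real ler01).
by move=> t [_ /eqP/negPf ->]; rewrite normc0.
Qed.

(** The pairing of ell^1 with bounded functions converges absolutely; the bound
serves both as summability and as norm estimate. *)
Lemma weighted_esum f (h : S -> R[i]) (B : R) : 0 <= B ->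
  (forall s, normc (h s) <= B) ->
  (abs_esum [set: S] (fun s => ((f s : R[i]) * h s)%R) <= (rnorm f * B)%:E)%E.
Proof.
move=> B0 hB; rewrite mulrC EFinM rnorm_ell1 ell1_normE /abs_esum -esumZ //; last first.
  by move=> s; rewrite lee_fin normc_ge0.
apply: le_esum => s _; rewrite -EFinM lee_fin normcM mulrC.
by rewrite ler_wpM2r ?normc_ge0.
Qed.

(** The sum over s_0, ..., s_(m-1) of
a_0(s_0) ... a_(m-1)(s_(m-1)) phi(s_0, ..., s_(m-1), 1, 1, ...), one variable at
a time, so that linearity and continuity follow from the case of one
variable. *)
Fixpoint extend m phi a : R[i] :=
  if m is m'.+1 then
    csum [set: S] (fun s => (a 0 s : R[i]) *
      extend m' (fun x => phi (scons s x)) (fun k => a k.+1))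
  else phi (fun=> one).

Lemma extend_bound m phi a (c : R) : (forall x, normc (phi x) <= c) ->
  normc (extend m phi a) <= c * \prod_(i < m) rnorm (a i).
Proof.
have c0 psi (c' : R) : (forall x : nat -> S, normc (psi x) <= c') -> 0 <= c'.
  by move=> /(_ (fun=> one)); apply: le_trans; exact: normc_ge0.
elim: m phi a => [|m IH] phi a pc; first by rewrite /= big_ord0 mulr1.
rewrite -lee_fin /=; set B := c * \prod_(i < m) rnorm (a i.+1).
have B0 : 0 <= B.
  by apply: mulr_ge0; [exact: c0 pc | apply: prodr_ge0 => i _; exact: rnorm_ge0].
have hB s : normc (extend m (fun x => phi (scons s x)) (fun k => a k.+1)) <= B.
  exact: IH.
have le := weighted_esum (a 0) B0 hB.
rewrite (le_trans (normc_csum _)) ?(le_lt_trans le) ?ltry // (le_trans le) //.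
by rewrite lee_fin big_ord_recl mulrCA.
Qed.

Lemma extend_summable m phi a (b : L1) (c : R) : (forall x, normc (phi x) <= c) ->
  (abs_esum [set: S] (fun s => ((b s : R[i]) *
     extend m (fun x => phi (scons s x)) a)%R) < +oo)%E.
Proof.
move=> pc; apply: (@le_lt_trans _ _ (rnorm b * (c * \prod_(i < m) rnorm (a i)))%:E); last exact: ltry.
apply: weighted_esum => [|s]; last exact: extend_bound.
apply: mulr_ge0; last by apply: prodr_ge0 => i _; exact: rnorm_ge0.
by apply: le_trans (pc (fun=> one)); exact: normc_ge0.
Qed.

Lemma extend_linear m phi a i (k : R[i]) f g (c : R) :
  (forall x, normc (phi x) <= c) -> (i < m)%N ->
  extend m phi (update a i (k *: f + g)) =
  k * extend m phi (update a i f) + extend m phi (update a i g).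
Proof.
elim: m phi a i => [//|m IH] phi a [|i] pc im.
  have sum b := extend_summable m (fun k => a k.+1) b pc.
  rewrite /= /update /= -csumZ // -csumD //.
    congr csum; apply/funext => s; rewrite mulrA -mulrDl; congr (_ * _).
  by rewrite abs_esumZ lte_mul_pinfty // lee_fin normc_ge0.
have sum b := extend_summable m
  (fun k => update a i.+1 b k.+1) (update a i.+1 b 0) pc.
rewrite /= -csumZ // -csumD //; last first.
  by rewrite abs_esumZ lte_mul_pinfty // lee_fin normc_ge0.
congr csum; apply/funext => s.
rewrite (IH (fun x => phi (scons s x)) (fun k => a k.+1)) //.
by rewrite /update /= mulrDr mulrCA.
Qed.

Lemma extend_basis m phi x : (forall k, (m <= k)%N -> x k = one) ->
  extend m phi (fun k => ell1_basis R (x k)) = phi x.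
Proof.
elim: m phi x => [|m IH] phi x x1 /=.
  by congr phi; apply/funext => k; rewrite x1.
rewrite (@csum1 _ _ _ _ (x 0)) //= => [|s /negPf->]; last by rewrite mul0r.
rewrite eqxx mul1r IH ?sconsE // => k mk; exact: x1.
Qed.

End Extension.

(** * Cochains with values in the dual as functions on tuples *)

Section CochainsOnBasis.
Variables (R : realType) (S : semigroupType) (one : S).
Local Notation A := (ell1 R S : banachAlgType R[i]).
Local Notation e := (ell1_basis R).

Lemma dual_basis_eq0 (f : dual A) : (forall s, f (e s) = 0) -> f = 0.
Proof.
move=> f0; apply: val_inj; apply/funext => a /=.
apply: (@ell1_ext0 R S R[i]^o f (dual_norm f)).
- by move=> x y; rewrite linearD.
- exact: dual_normP.
- by move=> k s; rewrite linearZ /= f0 scaler0.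
Qed.

(** The density of the span of the basis is applied to one argument at a time:
by induction on k, F vanishes as soon as the arguments from position k on are
basis vectors. *)
Lemma cochain_basis_eq0 n (F : cochain A (dual A) n) :
  (forall (y : 'I_n -> S) s, F (fun i => e (y i)) (e s) = 0) -> F = 0.
Proof.
move=> F0; have [lF /multibounded_ge0[c c0 Fc]] := cochainP F.
suff H k : (k <= n)%N -> forall v, (forall i : 'I_n, (k <= i)%N ->
    exists s, v i = e s) -> F v = 0.
  by apply: val_inj; apply/funext => v; apply: (H n) => // i; rewrite leqNgt ltn_ord.
elim: k => [|k IH] kn v vb.
  have [y vy] := choice (fun i => vb i isT).
  have -> : v = fun i => e (y i) by apply/funext.
  by apply: dual_basis_eq0 => s; exact: F0.
pose L a := F (set_arg v (Ordinal kn) a).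
have -> : F v = L (v (Ordinal kn)).
  by rewrite /L; congr (cochain_fun F _); apply/funext => i; rewrite /set_arg; case: eqP => [->|].
have [r r0 cr] := nneg_complexP c0.
apply: (@ell1_ext0 R S (dual A) L
  (r * \prod_(i < n | i != Ordinal kn) rnorm (v i))).
- by move=> a b; rewrite /L -{1}[a]scale1r lF scale1r.
- move=> a; rewrite -lecR rnormE (le_trans (Fc _)) // cr.
  rewrite (bigD1 (Ordinal kn)) //= /set_arg eqxx !rmorphM /= -rnormE.
  rewrite [X in _ * (_ * X)](_ : _ = (\prod_(i < n | i != Ordinal kn) rnorm (v i))%:C).
    by rewrite mulrCA mulrC.
  rewrite rmorph_prod; apply: eq_bigr => i /negPf ik; rewrite ik; exact/esym/rnormE.
- move=> l s.
  have LZ : L (l *: e s) = l *: L (e s).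
    have L00 : L 0 = 0.
      by have := lF v (Ordinal kn) (-1) 0 0; rewrite scaler0 addr0 scaleN1r addNr.
    by have := lF v (Ordinal kn) l (e s) 0; rewrite addr0 -/(L 0) L00 addr0.
  rewrite LZ /L IH ?scaler0 // 1?ltnW // => i ki; rewrite /set_arg.
  case: eqP => [_|/eqP ik]; first by exists s.
  by apply: vb; rewrite ltn_neqAle ki andbT eq_sym -val_eqE in ik *.
Qed.

Definition symbol n (F : cochain A (dual A) n) (x : nat -> S) : R[i] :=
  F (fun i => e (x i.+1)) (e (x 0)).

Lemma symbol_bounded n (F : cochain A (dual A) n) :
  exists c : R[i], forall x, `|symbol F x| <= c.
Proof.
have [_ [c Fc]] := cochainP F; exists c => x.
have := Fc (fun i => e (x i.+1)); rewrite big1 => [|i _]; last first.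
  by rewrite -rnormE rnorm_basis.
rewrite mulr1; apply: le_trans; rewrite -rnormE normcEC lecR.
by rewrite (le_trans (dual_normP _ _)) // rnorm_basis mulr1.
Qed.

(** The dual actions multiply the evaluation point: the left action gives face 0,
the right one the cyclic face. *)
Lemma symbol_coboundary (mulC : forall s t : S, (s * t = t * s)%g) n
    (F : cochain A (dual A) n) x :
  symbol (coboundary F) x = codiff n (symbol F) x.
Proof.
rewrite /codiff big_ord_recl big_ord_recr /= expr0 mul1r addrA.
have bmulE s t : e s ** e t = e (s * t)%g by exact: convolution_basis.
rewrite /symbol.
have ED (f g : dual A) b : (f + g) b = f b + g b by [].
have EZ k (f : dual A) b : (k *: f) b = k * f b by [].
have Esum (G : 'I_n -> dual A) b : (\sum_i G i) b = \sum_i G i b.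
  by apply: (big_morph (fun f : dual A => f b : R[i])).
have CE v : coboundary F v = coboundary_fun F v by [].
rewrite CE /coboundary_fun !ED Esum; congr (_ + _ + _).
- rewrite [LHS](_ : _ = F (fun i => e (x (lift ord0 i).+1)) (e (x 0) ** e (x 1%N))) //.
  by rewrite bmulE.
- apply: eq_bigr => j _; rewrite EZ /bump leq0n add1n; congr (_ * _).
  rewrite /face ltnS ltn_ord /merge_at /=; congr (cochain_fun F _ _).
  apply/funext => i; rewrite /merge_args /= /bump leq0n add1n.
  rewrite eqSS val_eqE.
  have [ij|ji] := ltnP i j; first by rewrite -val_eqE ltn_eqF // !ltnS leqNgt (ltn_trans ij).
  have [->|nij] := eqVneq i j; first exact: bmulE.
  by rewrite !ltnS ltn_neqAle ji eq_sym val_eqE nij.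
rewrite EZ /bump leq0n add1n; congr (_ * _).
rewrite [LHS](_ : _ = F (fun i => e (x (widen_ord (leqnSn n) i).+1))
   (e (x n.+1) ** e (x 0))) // bmulE mulC /face ltnn /merge_at /=.
congr (cochain_fun F _ _); apply/funext => i; rewrite /= /bump.
by rewrite !ltnS leqNgt ltn_ord.
Qed.

(** Sequences that equal 1 beyond position m stand for (m+1)-tuples; this form is
stable under faces, which shift the constant tail and shorten the tuple by one
entry. *)
Lemma exists_cochain m (phi : (nat -> S) -> R[i]) (c : R[i]) :
  (forall x, `|phi x| <= c) ->
  exists G : cochain A (dual A) m, forall x,
    (forall k, (m < k)%N -> x k = one) -> symbol G x = phi x.
Proof.
move=> pc.
have c0 : 0 <= c by apply: le_trans (pc (fun=> one)); exact: normr_ge0.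
have [r r0 cr] := nneg_complexP c0.
have pr x : normc (phi x) <= r by rewrite -lecR -cr -normcEC.
(* The padding is the basis vector at 1, so that basis vectors are padded to a
   sequence of basis vectors, to which extend_basis applies. *)
pose G (v : 'I_m -> A) (b : A) : R[i]^o := extend one m.+1 phi (scons b (pad (e one) v)).
have Gb v b : normc (G v b) <= r * (\prod_(i < m) rnorm (v i)) * rnorm b.
  rewrite (le_trans (extend_bound _ _ _ pr)) // big_ord_recl mulrCA mulrC /=.
  rewrite le_eqVlt; apply/orP; left; apply/eqP; congr (_ * _ * _).
  by apply: eq_bigr => i _; rewrite /= pad_ord.
have Gd v : G v \in @dual_pred R A.
  apply/asboolP; split=> [k a b|]; last by eexists; exact: Gb.
  have GE d : G v d = extend one m.+1 phi (update (scons 0 (pad (e one) v)) 0 d).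
    by rewrite -scons_update0.
  by rewrite !GE (extend_linear _ _ _ _ _ pr).
have Gc : (fun v => Dual (Gd v)) \in @cochain_pred _ A (dual A) m.
  apply/asboolP; split=> [v i k a b|].
    apply: val_inj; apply/funext => d /=.
    rewrite [RHS](_ : _ = k * G (set_arg v i a) d + G (set_arg v i b) d) //.
    rewrite /G !pad_set_arg !scons_updateS (extend_linear _ _ _ _ _ pr) //.
    by rewrite ltnS.
  exists c => v; rewrite cr -rnormE.
  rewrite (eq_bigr (fun i => (rnorm (v i))%:C)) => [|i _]; last by rewrite rnormE.
  rewrite -rmorph_prod -rmorphM lecR rnorm_dual; apply: dual_norm_le => [|b].
    by rewrite mulr_ge0 ?prodr_ge0 // => i _; rewrite rnorm_ge0.
  exact: Gb.
exists (Cochain Gc) => x x1; rewrite -(extend_basis (m := m.+1) phi x1).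
have -> : symbol (Cochain Gc) x = G (fun i => e (x i.+1)) (e (x 0)) by [].
rewrite /G; congr (extend one m.+1 phi _).
apply/funext => -[//|k] /=; have [km|mk] := ltnP k m.
  by rewrite -[k]/(val (Ordinal km)) pad_ord.
by rewrite pad_ge // x1.
Qed.

End CochainsOnBasis.

Theorem theorem4p2 (R : realType) (S : semigroupType)
    (S_semilattice : is_semilattice S) (S_unital : is_unital S) :
  simplicially_trivial (ell1 R S).
Proof.
case: S_semilattice => mulC mulss; case: S_unital => one one_unit.
have mul1 s := (one_unit s).1.
move=> [//|m] _; apply/Hochschild_trivialP => F dF.
have [c Fc] := symbol_bounded F.
have dsym x : codiff m.+1 (symbol F) x = 0.
  by rewrite -symbol_coboundary // dF.
have [phi [[d phid] dphi]] := exists_primitive mulC mulss mul1 Fc dsym.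
have [G GP] := exists_cochain one m phid.
exists G; apply/subr0_eq/cochain_basis_eq0 => y s.
set x := scons s (pad one y).
have -> : (fun i => ell1_basis R (y i)) = fun i => ell1_basis R (x i.+1).
  by apply/funext => i; rewrite /= pad_ord.
rewrite [LHS](_ : _ = symbol (coboundary G) x - symbol F x) //.
rewrite symbol_coboundary // -dphi -codiffB; apply: big1 => i _.
rewrite GP ?subrr ?mulr0 // => k mk.
rewrite /face /merge_at /bump.
have x1 j : (m.+1 < j)%N -> x j = one by case: j => // j mj; exact: pad_ge.
have := ltn_ord i => im.
by repeat case: ifP => ?; try (exfalso; lia); apply: x1; lia.
Qed.
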